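(* Let $I\in\mathbb{S}$ and $q\in\mathbb{H}$. Then for every integer $k\ge0$: (i) $\displaystyle Q_k(q)=-\frac{1}{2(k+1)(k+2)}\int_{\mathbb{C}_I}K_{\mathcal{F}}(q,p)\,p^{k+2}\,d\mu_I(p)$; (ii) $\displaystyle Q_k(q)=-\frac{1}{4\pi^{1/4}\,2^{k/2}(k+1)(k+2)}\int_{\mathbb{R}}\Phi(q,x)\,h_{k+2}(x)\,dx$.
   Context: $\mathbb{H}$ denotes the quaternions, $\mathbb{S}=\{I\in\mathbb{H}:I^2=-1\}$, $\mathbb{C}_I=\mathbb{R}+\mathbb{R}I$, $d\mu_I(p)=\frac1\pi e^{-|p|^2}d\lambda_I(p)$ with $d\lambda_I$ Lebesgue measure on $\mathbb{C}_I$. $Q_k(q)=\sum_{j=0}^k\frac{2(k-j+1)}{(k+1)(k+2)}q^{k-j}\overline q^{\,j}$. The Fock-Fueter kernel is $K_{\mathcal{F}}(q,p)=\Delta_q\sum_{k\ge0}\frac{q^k\overline p^k}{k!}$, where $\Delta_q$ is the Laplacian on $\mathbb{R}^4\cong\mathbb{H}$ in the variable $q$. The Hermite functions are $h_k(x)=(-1)^ke^{x^2/2}\frac{d^k}{dx^k}e^{-x^2}$, with $\|h_k\|^2_{L^2}=2^kk!\sqrt\pi$, and the Segal-Bargmann-Fueter kernel is $\Phi(q,x)=-\frac{1}{\pi^{1/4}}\sum_{k=0}^\infty\frac{Q_k(q)h_{k+2}(x)}{2^{k/2}k!}$ (equivalently $\Phi(q,x)=\int_{\mathbb{C}_I}K_{\mathcal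 F}(q,p)A(p,x)d\mu_I(p)$ with $A(p,x)=\pi^{-1/4}e^{-\frac12(p^2+x^2)+\sqrt2px}$). *)

(* Defs.v *)
From HB Require Import structures.
From mathcomp Require Import all_boot all_order all_algebra.
From mathcomp Require Import all_classical all_reals all_analysis.
From mathcomp Require Import ring.

Set Implicit Arguments.
Unset Strict Implicit.
Unset Printing Implicit Defensive.

Import Order.TTheory GRing.Theory Num.Theory.
Import numFieldNormedType.Exports.

Local Open Scope classical_set_scope.
Local Open Scope ring_scope.

(* The quaternion x0 + x1 i + x2 j + x3 k is the row vector (x0, x1, x2, x3).
   Pitfall: the norm `|q| inherited from 'rV[R]_4 is the sup norm, which gives
   the usual topology and differential calculus of R^4 but is not the modulus
   of q; for the latter see qmod. *)
Definition quat (R : realType) : Type := 'rV[R]_4.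

HB.instance Definition _ (R : realType) :=
  NormedModule.copy (quat R) 'rV[R]_4.
HB.instance Definition _ (R : realType) :=
  Complete.copy (quat R) 'rV[R]_4.

Section Quaternions.
Context {R : realType}.
Implicit Types p q : quat R.

Definition qcoord q (i : 'I_4) : R := (q : 'rV[R]_4) ord0 i.

Definition mkquat (a b c d : R) : quat R :=
  \row_(i < 4) nth 0 [:: a; b; c; d] i.

Definition qre q : R := qcoord q (inord 0).
Definition qi q : R := qcoord q (inord 1).
Definition qj q : R := qcoord q (inord 2).
Definition qk q : R := qcoord q (inord 3).

Lemma mkquatE a b c d :
  ((qre (mkquat a b c d) = a) * (qi (mkquat a b c d) = b) *
   (qj (mkquat a b c d) = c) * (qk (mkquat a b c d) = d))%type.
Proof. by rewrite /qre /qi /qj /qk /qcoord !mxE !inordK. Qed.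

Lemma quatP p q :
  qre p = qre q -> qi p = qi q -> qj p = qj q -> qk p = qk q -> p = q.
Proof.
move=> h0 h1 h2 h3; apply/rowP => i; rewrite -[i]inord_val.
by case: i => [[|[|[|[|//]]]]] ?.
Qed.

Lemma quat_addE p q :
  ((qre (p + q)%R = (qre p + qre q)%R) * (qi (p + q)%R = (qi p + qi q)%R) *
   (qj (p + q)%R = (qj p + qj q)%R) * (qk (p + q)%R = (qk p + qk q)%R))%type.
Proof. by rewrite /qre /qi /qj /qk /qcoord !mxE. Qed.

Lemma quat_scaleE (a : R) q :
  ((qre (a *: q)%R = (a * qre q)%R) * (qi (a *: q)%R = (a * qi q)%R) *
   (qj (a *: q)%R = (a * qj q)%R) * (qk (a *: q)%R = (a * qk q)%R))%type.
Proof. by rewrite /qre /qi /qj /qk /qcoord !mxE. Qed.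

Definition qone : quat R := mkquat 1 0 0 0.

Definition qmul p q : quat R := mkquat
  (qre p * qre q - qi p * qi q - qj p * qj q - qk p * qk q)
  (qre p * qi q + qi p * qre q + qj p * qk q - qk p * qj q)
  (qre p * qj q - qi p * qk q + qj p * qre q + qk p * qi q)
  (qre p * qk q + qi p * qj q - qj p * qi q + qk p * qre q).

Lemma qmulA : associative qmul.
Proof. by move=> x y z; apply: quatP; rewrite !mkquatE; ring. Qed.

Lemma qmul1q : left_id qone qmul.
Proof. by move=> x; apply: quatP; rewrite !mkquatE; ring. Qed.

Lemma qmulq1 : right_id qone qmul.
Proof. by move=> x; apply: quatP; rewrite !mkquatE; ring. Qed.

Lemma qmulDl : left_distributive qmul +%R.
Proof.
by move=> x y z; apply: quatP; rewrite !(mkquatE, quat_addE); ring.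
Qed.

Lemma qmulDr : right_distributive qmul +%R.
Proof.
by move=> x y z; apply: quatP; rewrite !(mkquatE, quat_addE); ring.
Qed.

Lemma qone_neq0 : qone != 0.
Proof.
apply/eqP => /(congr1 qre); rewrite mkquatE /qre /qcoord mxE.
exact/eqP/oner_neq0.
Qed.

Lemma qscaleAl (a : R) p q : a *: qmul p q = qmul (a *: p) q.
Proof. by apply: quatP; rewrite !(mkquatE, quat_scaleE); ring. Qed.

Lemma qscaleAr (a : R) p q : a *: qmul p q = qmul p (a *: q).
Proof. by apply: quatP; rewrite !(mkquatE, quat_scaleE); ring. Qed.

End Quaternions.

HB.instance Definition _ (R : realType) :=
  GRing.Zmodule_isNzRing.Build (quat R)
    qmulA qmul1q qmulq1 qmulDl qmulDr qone_neq0.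

HB.instance Definition _ (R : realType) :=
  GRing.Lmodule_isLalgebra.Build R (quat R) qscaleAl.

HB.instance Definition _ (R : realType) :=
  GRing.Lalgebra_isAlgebra.Build R (quat R) qscaleAr.

Section FockFueter.
Context {R : realType}.
Implicit Types p q I : quat R.

Definition qconj q : quat R := mkquat (qre q) (- qi q) (- qj q) (- qk q).

Definition qmod q : R := Num.sqrt (\sum_(i < 4) qcoord q i ^+ 2).

Definition imag_units : set (quat R) := [set I | I ^+ 2 = -1].

Definition slice I (z : R * R) : quat R := z.1%:A + z.2 *: I.

Definition laplacian (f : quat R -> quat R) q : quat R :=
  \sum_(i < 4) derive (derive f ^~ (delta_mx ord0 i)) q (delta_mx ord0 i).

Definition qseries (u : nat -> quat R) : quat R := limn (series u).

Definition qintegrable d (T : measurableType d)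
    (mu : {measure set T -> \bar R}) (f : T -> quat R) : Prop :=
  forall i : 'I_4, mu.-integrable setT (fun x => (qcoord (f x) i)%:E).

Definition qintegral d (T : measurableType d)
    (mu : {measure set T -> \bar R}) (f : T -> quat R) : quat R :=
  \row_(i < 4) \int[mu]_(x in setT) qcoord (f x) i.

Definition lebesgue2 :=
  (@lebesgue_measure R \x @lebesgue_measure R)%E.

(* I being a unit vector orthogonal to 1, Lebesgue measure on C_I is the
   planar Lebesgue measure in the coordinates (x, y) of x + y I. *)
Definition gauss_integrand I (f : quat R -> quat R) (z : R * R) : quat R :=
  let p := slice I z in (pi^-1 * expR (- qmod p ^+ 2)) *: f p.

Definition mu_integrable I (f : quat R -> quat R) : Prop :=
  qintegrable lebesgue2 (gauss_integrand I f).

Definition mu_integral I (f : quat R -> quat R) : quat R :=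
  qintegral lebesgue2 (gauss_integrand I f).

Definition Qpoly (k : nat) q : quat R :=
  \sum_(j < k.+1)
    ((2 * (k - j + 1)%:R) / ((k + 1)%:R * (k + 2)%:R) : R) *:
      (q ^+ (k - j) * qconj q ^+ j).

Definition fock_fueter_kernel q p : quat R :=
  laplacian
    (fun r => qseries (fun k => (k`!%:R^-1 : R) *: (r ^+ k * qconj p ^+ k))) q.

Definition hermite (k : nat) (x : R) : R :=
  (-1) ^+ k * expR (x ^+ 2 / 2) * derive1n k (fun y => expR (- y ^+ 2)) x.

Definition segal_bargmann_fueter_kernel q (x : R) : quat R :=
  - (pi `^ (1 / 4))^-1 *:
    qseries (fun k =>
      (hermite (k + 2) x / (2 `^ (k%:R / 2) * k`!%:R)) *: Qpoly k q).

End FockFueter.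

(* Main.v *)
From HB Require Import structures.
Require Import Defs.
From mathcomp Require Import all_boot all_order all_algebra.
From mathcomp Require Import all_classical all_reals all_analysis.
From mathcomp Require Import measurable_realfun.
From mathcomp Require Import ring lra zify.

(** Both formulas express the same fact: the kernel is a series whose [k]-th
    term is a multiple of [Qpoly k q] times an element of an orthogonal family
    (the powers of the conjugate of [p] in the Gaussian space of a slice, the
    Hermite functions on the line), so that integrating against an element of
    the family isolates one [Qpoly k q].

    The Fock-Fueter kernel is differentiated termwise. The Leibniz rule gives
    the Laplacian of [q ^ k] by recursion; since the sum of [e * x * e] over the four basis
    quaternions is [-2] times the conjugate of [x] ([sum_qunit_sandwich]), the
    recursion produces the conjugates of [q], and its solution is
    [- 2 * (k + 1) * (k + 2) * Qpoly k q] for the exponent [k + 2]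
    ([lap_powSSE]). First and second derivatives and Taylor remainders of
    [q ^ k] grow at most geometrically in [k], and the factor [1 / k!] makes
    the differentiated series converge; hence [fock_fueter_kernelE].

    On a slice, let [T m n] be [conj p ^ m * p ^ n] times [exp (- |p| ^ 2)].
    Its derivatives with respect to [p] and to [conj p] have integral 0, which
    gives recurrences for the integral [J m n] of [T m n] over the plane:
    [J m.+1 n = n * J m n.-1] and [J m n.+1 = m * J m.-1 n]. Together with
    [J 0 0 = pi] they yield [J m n = 0] for [m <> n] and [J n n = n! * pi]
    ([gauss_momentE]). On the line, integration by parts together with
    [H_n' = 2 n H_(n-1)] gives the orthogonality of the Hermite functions in
    the same way ([gauss_int_hermite]).

    Exchanging sum and integral ([qintegral_qseries1]) needs a bound of the
    [j]-th term by [2^-j] times one integrable function. On the slice this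
    comes from [r ^ j / j! <= exp r]. On the line it comes from
    [|H_n x| * t ^ n <= n! * exp (2 |x| t + 2 t ^ 2)], where [t > 0] is free
    ([hermite_poly_bound]). In both cases a Gaussian absorbs an exponential of
    [|x|], by [c|x| <= c^2/2 + x^2/2]. *)

Set Implicit Arguments.
Unset Strict Implicit.
Unset Printing Implicit Defensive.

Import Order.TTheory GRing.Theory Num.Theory.
Import numFieldNormedType.Exports.
Local Open Scope classical_set_scope.
Local Open Scope ring_scope.

(** * Quaternion algebra and the l1 norm *)

Section QuaternionAlgebra.
Context {R : realType}.
Implicit Types (p q x y : quat R) (a b : R).

Lemma quat_mulE p q :
  ((qre (p * q)%R =
      (qre p * qre q - qi p * qi q - qj p * qj q - qk p * qk q)%R) *
   (qi (p * q)%R =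
      (qre p * qi q + qi p * qre q + qj p * qk q - qk p * qj q)%R) *
   (qj (p * q)%R =
      (qre p * qj q - qi p * qk q + qj p * qre q + qk p * qi q)%R) *
   (qk (p * q)%R =
      (qre p * qk q + qi p * qj q - qj p * qi q + qk p * qre q)%R))%type.
Proof. by rewrite !mkquatE. Qed.

Lemma quat_oppE q :
  ((qre (- q)%R = (- qre q)%R) * (qi (- q)%R = (- qi q)%R) *
   (qj (- q)%R = (- qj q)%R) * (qk (- q)%R = (- qk q)%R))%type.
Proof. by rewrite /qre /qi /qj /qk /qcoord !mxE. Qed.

Lemma quat_oneE :
  ((qre (1 : quat R) = 1) * (qi (1 : quat R) = 0) *
   (qj (1 : quat R) = 0) * (qk (1 : quat R) = 0))%type.
Proof. by rewrite !mkquatE. Qed.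

Lemma quat_zeroE :
  ((qre (0 : quat R) = 0) * (qi (0 : quat R) = 0) *
   (qj (0 : quat R) = 0) * (qk (0 : quat R) = 0))%type.
Proof. by rewrite /qre /qi /qj /qk /qcoord !mxE. Qed.

Lemma quat_conjE q :
  ((qre (qconj q) = qre q) * (qi (qconj q) = - qi q) *
   (qj (qconj q) = - qj q) * (qk (qconj q) = - qk q))%type.
Proof. by rewrite !mkquatE. Qed.

Definition quatE :=
  (quat_mulE, @quat_addE R, quat_oppE, @quat_scaleE R, quat_oneE, quat_zeroE,
   quat_conjE, @mkquatE R).

Lemma qcoordP (P : 'I_4 -> Prop) :
  P (inord 0) -> P (inord 1) -> P (inord 2) -> P (inord 3) -> forall i, P i.
Proof.
by move=> ? ? ? ? i; rewrite -[i]inord_val; case: i => [[|[|[|[|//]]]]] ?.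
Qed.

Lemma sum_qcoord (V : nmodType) (f : 'I_4 -> V) :
  \sum_(i < 4) f i = f (inord 0) + f (inord 1) + f (inord 2) + f (inord 3).
Proof.
rewrite !big_ord_recr big_ord0 /= add0r.
by congr (f _ + f _ + f _ + f _); apply/val_inj; rewrite /= inordK.
Qed.

Lemma qconjM p q : qconj (p * q) = qconj q * qconj p.
Proof. by apply: quatP; rewrite !quatE; ring. Qed.

Lemma comm_qconj q : GRing.comm q (qconj q).
Proof. by apply: quatP; rewrite !quatE; ring. Qed.

Definition qunit (i : 'I_4) : quat R := delta_mx ord0 i.

Lemma qunitE :
  ((qunit (inord 0) = mkquat 1 0 0 0) * (qunit (inord 1) = mkquat 0 1 0 0) *
   (qunit (inord 2) = mkquat 0 0 1 0) * (qunit (inord 3) = mkquat 0 0 0 1))%type.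
Proof.
do !split; apply: quatP; rewrite ?mkquatE /qre /qi /qj /qk /qcoord !mxE;
  by rewrite ?eqxx -?val_eqE /= ?inordK.
Qed.

(** The identity behind the shape of [Qpoly]: it is where conjugates of the
    variable enter the Laplacian of a power. *)
Lemma sum_qunit_sandwich x :
  \sum_(i < 4) qunit i * x * qunit i = (- 2) *: qconj x.
Proof. by rewrite sum_qcoord !qunitE; apply: quatP; rewrite !quatE; ring. Qed.

(** Estimates use the l1 norm instead of the modulus: it is submultiplicative
    because the product of two basis quaternions is a basis quaternion up to
    sign, and its triangle inequality holds coordinatewise, whereas the modulus
    would require Cauchy-Schwarz. *)
Definition qnorm1 q : R := \sum_(i < 4) `|qcoord q i|.
Local Notation N1 := qnorm1.

Lemma qnorm1E q : N1 q = `|qre q| + `|qi q| + `|qj q| + `|qk q|.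
Proof. exact: sum_qcoord. Qed.

Lemma qnorm1_ge0 q : 0 <= N1 q. Proof. exact: sumr_ge0. Qed.

Lemma qcoord_le_qnorm1 q i : `|qcoord q i| <= N1 q.
Proof. by rewrite /N1 (bigD1 i)//= lerDl sumr_ge0. Qed.

Lemma qnorm1D p q : N1 (p + q) <= N1 p + N1 q.
Proof.
by rewrite -big_split; apply: ler_sum => i _; rewrite /qcoord mxE ler_normD.
Qed.

Lemma qnorm1Z a q : N1 (a *: q) = `|a| * N1 q.
Proof.
by rewrite mulr_sumr; apply: eq_bigr => i _; rewrite /qcoord mxE normrM.
Qed.

Lemma qnorm1_0 : N1 0 = 0.
Proof. by rewrite -(scale0r 0) qnorm1Z normr0 mul0r. Qed.

Lemma qnorm1_1 : N1 1 = 1.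
Proof. by rewrite qnorm1E !quatE normr1 !normr0 !addr0. Qed.

Lemma qnorm1_conj q : N1 (qconj q) = N1 q.
Proof. by rewrite !qnorm1E !quatE !normrN. Qed.

Lemma qnorm1M p q : N1 (p * q) <= N1 p * N1 q.
Proof.
rewrite !qnorm1E !quatE.
have H (a b c d : R) : `|a + b + c + d| <= `|a| + `|b| + `|c| + `|d|.
  by do 2 (apply: (le_trans (ler_normD _ _)); rewrite lerD2r); exact: ler_normD.
apply: (@le_trans _ _ (
  (`|qre p * qre q| + `|- (qi p * qi q)| + `|- (qj p * qj q)| + `|- (qk p * qk q)|)
+ (`|qre p * qi q| + `|qi p * qre q| + `|qj p * qk q| + `|- (qk p * qj q)|)
+ (`|qre p * qj q| + `|- (qi p * qk q)| + `|qj p * qre q| + `|qk p * qi q|)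
+ (`|qre p * qk q| + `|qi p * qj q| + `|- (qj p * qi q)| + `|qk p * qre q|))).
  by rewrite !lerD.
by rewrite !normrN !normrM le_eqVlt; apply/orP; left; apply/eqP; ring.
Qed.

Lemma qnorm1X q n : N1 (q ^+ n) <= N1 q ^+ n.
Proof.
elim: n => [|n IH]; first by rewrite !expr0 qnorm1_1.
by rewrite !exprS (le_trans (qnorm1M _ _))// ler_wpM2l ?qnorm1_ge0.
Qed.

Lemma norm_le_qnorm1 q : `|q| <= N1 q.
Proof.
rewrite /Num.Def.normr/= mx_normrE; apply: bigmax_le => [|[i j] _ /=].
  exact: qnorm1_ge0.
by rewrite (ord1 i); exact: qcoord_le_qnorm1.
Qed.

Lemma qnorm1_qunit i : N1 (qunit i) = 1.
Proof.
rewrite /N1 (bigD1 i)//= big1 => [|j ji]; rewrite /qcoord mxE !eqxx.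
  by rewrite normr1 addr0.
by rewrite (negbTE ji) normr0.
Qed.

Lemma qnorm1_sum I (r : seq I) (f : I -> quat R) :
  N1 (\sum_(i <- r) f i) <= \sum_(i <- r) N1 (f i).
Proof.
elim/big_rec2 : _ => [|i y1 y2 _ h]; first by rewrite qnorm1_0.
by rewrite (le_trans (qnorm1D _ _))// lerD2l.
Qed.

End QuaternionAlgebra.

(** * Directional derivatives and Laplacian of quaternionic powers *)

Section PowerDerivatives.
Context {R : realType}.
Implicit Types (r e x q : quat R).
Local Notation N1 := qnorm1.

(** First and second derivatives at [r], in the direction [e], of the [k]-th
    power, generated by the Leibniz rule. *)
Fixpoint dpow r e k : quat R :=
  if k is k'.+1 then dpow r e k' * r + r ^+ k' * e else 0.

Fixpoint ddpow r e k : quat R :=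
  if k is k'.+1 then ddpow r e k' * r + 2 *: (dpow r e k' * e) else 0.

Lemma qnorm1M_le p q (a b : R) : N1 p <= a -> N1 q <= b -> N1 (p * q) <= a * b.
Proof.
by move=> pa qb; rewrite (le_trans (qnorm1M _ _))// ler_pM// qnorm1_ge0.
Qed.

Lemma qnorm1_dpow r e (rho : R) k : 1 <= rho -> N1 r <= rho -> N1 e <= 1 ->
  N1 (dpow r e k) <= (2 * rho) ^+ k.
Proof.
move=> rho1 rr e1; have rho0 : 0 <= rho by exact: le_trans rho1.
elim: k => [|k IH] /=; first by rewrite qnorm1_0.
apply: (le_trans (qnorm1D _ _)).
have h1 := qnorm1M_le IH rr.
have h2 : N1 (r ^+ k * e) <= rho ^+ k * 1.
  apply: qnorm1M_le => //; rewrite (le_trans (qnorm1X _ _))//.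
  by rewrite lerXn2r ?nnegrE ?qnorm1_ge0.
have h3 : rho ^+ k <= (2 * rho) ^+ k by rewrite lerXn2r ?nnegrE; lra.
apply: (le_trans (lerD h1 h2)); rewrite exprS.
have : 0 <= (2 * rho) ^+ k by rewrite exprn_ge0 ?mulr_ge0.
nra.
Qed.

Lemma qnorm1_ddpow r e (rho : R) k : 1 <= rho -> N1 r <= rho -> N1 e <= 1 ->
  N1 (ddpow r e k) <= (3 * rho) ^+ k.
Proof.
move=> rho1 rr e1; have rho0 : 0 <= rho by exact: le_trans rho1.
elim: k => [|k IH] /=; first by rewrite qnorm1_0.
apply: (le_trans (qnorm1D _ _)); rewrite qnorm1Z ger0_norm//.
have h1 := qnorm1M_le IH rr.
have h2 := qnorm1M_le (qnorm1_dpow k rho1 rr e1) e1.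
have h3 : (2 * rho) ^+ k <= (3 * rho) ^+ k by rewrite lerXn2r ?nnegrE; lra.
apply: (le_trans (lerD h1 (ler_wpM2l _ h2))) => //; rewrite exprS.
have : 0 <= (3 * rho) ^+ k by rewrite exprn_ge0 ?mulr_ge0.
nra.
Qed.

(** Expanding [(h e + r) ^ k] in the noncommutative algebra gives a remainder
    of order [h ^ 2] by a recursion in [k]; the geometric bound is what makes
    the remainders summable after division by [k!]. *)
Lemma pow_taylor r e (h rho : R) k :
  `|h| <= 1 -> N1 r + 1 <= rho -> N1 e <= 1 ->
  exists2 E : quat R, (h *: e + r) ^+ k = r ^+ k + h *: dpow r e k + h ^+ 2 *: E
    & N1 E <= (3 * rho) ^+ k.
Proof.
move=> h1 rr e1; have r0 := qnorm1_ge0 r.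
have rho1 : 1 <= rho by lra.
have rho0 : 0 <= rho by exact: le_trans rho1.
have her : N1 (h *: e + r) <= rho.
  rewrite (le_trans (qnorm1D _ _))// qnorm1Z (le_trans _ rr)// addrC lerD2l.
  by rewrite mulr_ile1 ?qnorm1_ge0.
elim: k => [|k [E EE IH]] /=.
  by exists 0; rewrite ?qnorm1_0// !expr0 !scaler0 !addr0.
exists (E * (h *: e + r) + dpow r e k * e).
  by rewrite exprSr EE; apply: quatP; rewrite [r ^+ k.+1]exprSr !quatE; ring.
apply: (le_trans (qnorm1D _ _)).
have h2 := qnorm1M_le IH her.
have rr' : N1 r <= rho by lra.
have h3 := qnorm1M_le (qnorm1_dpow k rho1 rr' e1) e1.
have h4 : (2 * rho) ^+ k <= (3 * rho) ^+ k by rewrite lerXn2r ?nnegrE; lra.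
apply: (le_trans (lerD h2 h3)); rewrite exprS.
have : 0 <= (3 * rho) ^+ k by rewrite exprn_ge0 ?mulr_ge0.
nra.
Qed.

Lemma dpow_taylor r e (h rho : R) k :
  `|h| <= 1 -> N1 r + 1 <= rho -> N1 e <= 1 ->
  exists2 F : quat R,
    dpow (h *: e + r) e k = dpow r e k + h *: ddpow r e k + h ^+ 2 *: F
    & N1 F <= (4 * rho) ^+ k.
Proof.
move=> h1 rr e1; have r0 := qnorm1_ge0 r.
have rho1 : 1 <= rho by lra.
have rho0 : 0 <= rho by exact: le_trans rho1.
have her : N1 (h *: e + r) <= rho.
  rewrite (le_trans (qnorm1D _ _))// qnorm1Z (le_trans _ rr)// addrC lerD2l.
  by rewrite mulr_ile1 ?qnorm1_ge0.
elim: k => [|k [F FF IH]] /=.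
  by exists 0; rewrite ?qnorm1_0// !scaler0 !addr0.
have [E EE E3] := pow_taylor k h1 rr e1.
exists (F * (h *: e + r) + ddpow r e k * e + E * e).
  by rewrite FF EE; apply: quatP; rewrite !quatE; ring.
apply: (le_trans (qnorm1D _ _)).
have rr' : N1 r <= rho by lra.
have h2 := qnorm1M_le IH her.
have h3 := qnorm1M_le (qnorm1_ddpow k rho1 rr' e1) e1.
have h4 := qnorm1M_le E3 e1.
have h5 : (3 * rho) ^+ k <= (4 * rho) ^+ k by rewrite lerXn2r ?nnegrE; lra.
apply: (le_trans (lerD (le_trans (qnorm1D _ _) (lerD h2 h3)) h4)); rewrite exprS.
have : 0 <= (4 * rho) ^+ k by rewrite exprn_ge0 ?mulr_ge0.
nra.
Qed.

Definition lap_pow r k : quat R := \sum_(i < 4) ddpow r (qunit i) k.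

(** Generalizing over a middle factor [x] closes the induction on [k]: the
    recursion of [dpow] replaces [x] by [r * x] and leaves one copy of the
    sandwich identity. *)
Lemma sum_dpow_sandwich r x k :
  \sum_(i < 4) dpow r (qunit i) k * x * qunit i =
  (- 2) *: \sum_(j < k) r ^+ j * (qconj x * qconj r ^+ (k.-1 - j)).
Proof.
elim: k x => [|k IH] x.
  by rewrite big1 => [|i _]; rewrite ?big_ord0 ?scaler0// !mul0r.
have split_e i : dpow r (qunit i) k.+1 * x * qunit i =
    dpow r (qunit i) k * (r * x) * qunit i + r ^+ k * (qunit i * x * qunit i).
  by rewrite /= !mulrDl !mulrA.
rewrite (eq_bigr _ (fun i _ => split_e i)) big_split IH -mulr_sumr.
rewrite sum_qunit_sandwich big_ord_recr.
rewrite [(k.+1.-1 - _)%N]subnn expr0 mulr1 scalerDr -scalerAr; congr (_ *: _ + _).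
apply: eq_bigr => j _; rewrite qconjM -mulrA -exprS.
by congr (_ * (_ * _ ^+ _)); have := ltn_ord j; rewrite /=; lia.
Qed.

Lemma sum_dpow_qunit r k : \sum_(i < 4) dpow r (qunit i) k * qunit i =
  (- 2) *: \sum_(j < k) r ^+ (k.-1 - j) * qconj r ^+ j.
Proof.
under eq_bigr => i _ do rewrite -[dpow _ _ _]mulr1.
rewrite sum_dpow_sandwich (reindex_inj rev_ord_inj)/=; congr (_ *: _).
have -> : qconj 1 = 1 :> quat R by apply: quatP; rewrite !quatE ?oppr0.
apply: eq_bigr => j _; rewrite mul1r; congr (_ ^+ _ * _ ^+ _);
  by have := ltn_ord j; lia.
Qed.

Lemma lap_powS r k : lap_pow r k.+1 =
  lap_pow r k * r - 4 *: \sum_(j < k) r ^+ (k.-1 - j) * qconj r ^+ j.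
Proof.
rewrite /lap_pow big_split/= -mulr_suml -scaler_sumr sum_dpow_qunit scalerA.
by rewrite mulrN scaleNr; congr (_ - _ *: _); rewrite -natrM.
Qed.

Lemma lap_pow0 r : lap_pow r 0 = 0. Proof. by rewrite /lap_pow big1. Qed.

(** Powers of [r] and of its conjugate commute, so multiplying the formula for
    [k.+2] by [r] raises each exponent of [r] by one, and the new sum given by
    [lap_powS] raises each coefficient by one. *)
Lemma lap_powSS r k : lap_pow r k.+2 =
  (- 4) *: \sum_(j < k.+1) ((k - j).+1%:R : R) *: (r ^+ (k - j) * qconj r ^+ j).
Proof.
have cX j : qconj r ^+ j * r = r * qconj r ^+ j.
  exact/esym/commrX/comm_qconj.
elim: k => [|k IH].
  rewrite !lap_powS lap_pow0 big_ord0 !big_ord1 scaler0 mul0r subrr mul0r add0r.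
  by rewrite scaleNr !subnn scale1r.
rewrite lap_powS IH -scalerAl mulr_suml -scaleNr -scalerDr; congr (_ *: _).
rewrite [in RHS]big_ord_recr [in X in _ + X]big_ord_recr/= addrA; congr (_ + _).
  rewrite -big_split; apply: eq_bigr => j _ /=; rewrite -scalerAl -mulrA cX mulrA.
  by rewrite -exprSr subSn ?leq_ord// -[in RHS]natr1 scalerDl scale1r.
by rewrite subnn scale1r.
Qed.

(** The source of [Qpoly]: up to a real factor it is the Laplacian of a power,
    normalized so that its coefficients add up to 1. *)
Lemma lap_powSSE r k :
  lap_pow r k.+2 = - (2 * (k + 1)%:R * (k + 2)%:R) *: Qpoly k r.
Proof.
rewrite lap_powSS /Qpoly !scaler_sumr; apply: eq_bigr => j _.
rewrite !scalerA; congr (_ *: _); rewrite (addn1 (k - j)).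
have k1 : (k + 1)%:R != 0 :> R by rewrite pnatr_eq0 addn1.
have k2 : (k + 2)%:R != 0 :> R by rewrite pnatr_eq0 addn2.
move: (k + 1)%:R (k + 2)%:R (k - j).+1%:R k1 k2 => a b c a0 b0.
by field; rewrite a0 b0.
Qed.

Lemma qnorm1_lap_pow r k : N1 (lap_pow r k) <= 4 * (3 * (N1 r + 1)) ^+ k.
Proof.
apply: (le_trans (qnorm1_sum _ _)).
apply: (@le_trans _ _ (\sum_(i < 4) (3 * (N1 r + 1)) ^+ k)).
  apply: ler_sum => i _; apply: qnorm1_ddpow; rewrite ?qnorm1_qunit// ?lerDl//.
  by rewrite lerDr qnorm1_ge0.
by rewrite sumr_const card_ord [4 * _]mulr_natl.
Qed.

End PowerDerivatives.

(** * Dominated series and their termwise differentiation *)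

Section DominatedSeries.
Context {R : realType} {V : completeNormedModType R}.
Implicit Types (u v : V ^nat) (M : R ^nat).

Lemma dominated_series_cvg u M :
  (forall k, `|u k| <= M k) -> cvgn (series M) -> cvgn (series u).
Proof.
move=> uM cM; apply: normed_cvg; apply: series_le_cvg cM => //= k.
exact: le_trans (normr_ge0 _) (uM k).
Qed.

Lemma dominated_series_le u M : (forall k, `|u k| <= M k) ->
  cvgn (series M) -> `|limn (series u)| <= limn (series M).
Proof.
move=> uM cM.
have cu : cvgn [normed series u].
  by apply: series_le_cvg cM => //= k; exact: le_trans (normr_ge0 _) (uM k).
by rewrite (le_trans (lim_series_norm cu))// lim_series_le.
Qed.

Lemma limn_seriesZ a u : cvgn (series u) ->
  limn (series (fun k => a *: u k)) = a *: limn (series u).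
Proof.
move=> cu; rewrite -limZl_tmp//.
by congr (limn _); apply/funext => n; rewrite /series/= -scaler_sumr.
Qed.

End DominatedSeries.

(** A first-order expansion of each term whose remainder is [h ^ 2] times a
    summable constant survives summation, and the difference quotient of the
    sum is then within [|h|] times the sum of these constants of the sum of
    the derivatives. *)
Lemma derive_series {R : realType} {W : normedModType R}
    {V : completeNormedModType R} (f : nat -> W -> V) (a e : W) (v : V ^nat)
    (M : R ^nat) :
  cvgn (series M) -> (forall k, `|v k| <= M k) ->
  (forall k h, `|h| <= 1 -> `|f k (h *: e + a)| <= M k) ->
  (forall k h, `|h| <= 1 ->
     `|f k (h *: e + a) - f k a - h *: v k| <= h ^+ 2 * M k) ->
  derive (fun r => limn (series (f ^~ r))) a e = limn (series v).
Proof.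
move=> cM vM fM rM; set F := fun r => _; set S := limn (series M).
have f0M k : `|f k a| <= M k.
  by have := fM k 0; rewrite normr0 scale0r add0r; apply.
have S0 : 0 <= S.
  by apply: (le_trans _ (dominated_series_le vM cM)).
have key h : `|h| <= 1 ->
    `|F (h *: e + a) - F a - h *: limn (series v)| <= h ^+ 2 * S.
  move=> h1.
  have c1 : cvgn (series (f ^~ (h *: e + a))).
    by apply: dominated_series_cvg cM => k; exact: fM.
  have c2 := dominated_series_cvg f0M cM.
  have c3 := dominated_series_cvg vM cM.
  have -> : F (h *: e + a) - F a - h *: limn (series v) =
      limn (series (fun k => f k (h *: e + a) - f k a - h *: v k)).
    rewrite /F -(limn_seriesZ _ c3) -!limB//; last 2 first.
    - exact: is_cvgB.
    - apply: (@dominated_series_cvg _ _ _ (fun k => `|h| *: M k)) => [k|].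
        by rewrite normrZ ler_wpM2l.
      exact: is_cvg_seriesZ.
    by congr (limn _); apply/funext => n; rewrite /series/= !sumrB.
  rewrite -[_ * S](lim_seriesZ (h ^+ 2) cM).
  apply: dominated_series_le; first by move=> k; exact: rM.
  exact: is_cvg_seriesZ.
apply/cvg_lim => //; apply/cvgrPdist_le => eps eps0.
near=> h.
have h0 : h != 0 by near: h; exact: nbhs_dnbhs_neq.
have h1 : `|h| <= 1 by near: h; exact: dnbhs0_le.
have hS : `|h| * (S + 1) <= eps.
  rewrite -ler_pdivlMr ?ltr_wpDl//; near: h; apply: dnbhs0_le.
  by rewrite divr_gt0// ltr_wpDl.
rewrite /= distrC.
have -> : h^-1 *: (F (h *: e + a) - F a) - limn (series v) =
    h^-1 *: (F (h *: e + a) - F a - h *: limn (series v)).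
  by rewrite [in RHS]scalerBr scalerA mulVf// scale1r.
rewrite normrZ normfV ler_pdivrMl ?normr_gt0// (le_trans (key h h1))//.
rewrite -real_normK ?num_real// expr2 -mulrA ler_wpM2l// (le_trans _ hS)//.
by rewrite ler_wpM2l// lerDl.
Unshelve. all: by end_near. Qed.

(** * The Fock-Fueter kernel as a series *)

Section Kernel.
Context {R : realType}.
Implicit Types (q p s a e : quat R) (rho : R).
Local Notation N1 := qnorm1.

(** The [k]-th term of a noncommutative exponential series whose [k]-th power
    of the first variable has been replaced by an arbitrary coefficient [x]:
    the kernel and its directional derivatives are all of this form. *)
Definition expterm s k (x : quat R) : quat R := (k`!%:R^-1 : R) *: (x * s ^+ k).

Lemma exptermD s k x y : expterm s k (x + y) = expterm s k x + expterm s k y.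
Proof. by rewrite /expterm mulrDl scalerDr. Qed.

Lemma exptermZ s k c x : expterm s k (c *: x) = c *: expterm s k x.
Proof. by rewrite /expterm -scalerAl !scalerA mulrC. Qed.

Lemma qnorm1_expterm s k x c b : N1 x <= c * b ^+ k ->
  N1 (expterm s k x) <= c * exp_coeff (b * N1 s) k.
Proof.
move=> xb; rewrite /expterm qnorm1Z ger0_norm ?invr_ge0// mulrC /exp_coeff/=.
rewrite mulrA ler_wpM2r ?invr_ge0// exprMn mulrA.
exact: (qnorm1M_le xb (qnorm1X _ _)).
Qed.

Lemma norm_expterm s k x b c : N1 x <= b ^+ k -> 0 <= b -> b <= c ->
  `|expterm s k x| <= exp_coeff (c * N1 s) k.
Proof.
move=> xb b0 bc; rewrite (le_trans (norm_le_qnorm1 _))//.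
rewrite -[leRHS]mul1r; apply: qnorm1_expterm; rewrite mul1r.
by rewrite (le_trans xb)// lerXn2r ?nnegrE// (le_trans b0).
Qed.

Lemma norm_expterm_taylor s k b c (h : R) x y z E :
  x = y + h *: z + h ^+ 2 *: E -> N1 E <= b ^+ k -> 0 <= b -> b <= c ->
  `|expterm s k x - expterm s k y - h *: expterm s k z|
    <= h ^+ 2 * exp_coeff (c * N1 s) k.
Proof.
move=> -> Eb b0 bc; rewrite !exptermD !exptermZ -addrA -opprD addrAC subrr add0r.
rewrite normrZ ger0_norm ?sqr_ge0// ler_wpM2l ?sqr_ge0//.
exact: norm_expterm Eb b0 bc.
Qed.

Lemma qnorm1_shift a e (h : R) : N1 e <= 1 -> `|h| <= 1 ->
  N1 (h *: e + a) <= N1 a + 1.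
Proof.
move=> e1 h1; rewrite (le_trans (qnorm1D _ _))// qnorm1Z addrC lerD2l.
by rewrite mulr_ile1 ?qnorm1_ge0.
Qed.

Lemma derive_expterm_pow s a e : N1 e <= 1 ->
  derive (fun r : quat R => qseries (fun k => expterm s k (r ^+ k))) a e =
  qseries (fun k => expterm s k (dpow a e k)).
Proof.
move=> e1; set rho := N1 a + 1.
have a0 := qnorm1_ge0 a.
have rho1 : 1 <= rho by rewrite lerDr.
have arho : N1 a <= rho by rewrite lerDl.
apply: (@derive_series _ (quat R) (quat R)
  (fun k (r : quat R) => expterm s k (r ^+ k))
  a e _ (exp_coeff (4 * rho * N1 s))) => [|k|k h h1|k h h1].
- exact: is_cvg_series_exp_coeff.
- by apply: norm_expterm (qnorm1_dpow k rho1 arho e1) _ _; lra.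
- apply: (@norm_expterm _ _ _ rho); [|lra|lra].
  rewrite (le_trans (qnorm1X _ _))// lerXn2r ?nnegrE ?qnorm1_ge0//; first lra.
  exact: qnorm1_shift.
- have [E EE Eb] := pow_taylor k h1 (lexx rho) e1.
  by apply: norm_expterm_taylor EE Eb _ _; lra.
Qed.

Lemma derive_expterm_dpow s a e : N1 e <= 1 ->
  derive (fun r : quat R => qseries (fun k => expterm s k (dpow r e k))) a e =
  qseries (fun k => expterm s k (ddpow a e k)).
Proof.
move=> e1; set rho := N1 a + 1.
have a0 := qnorm1_ge0 a.
have rho1 : 1 <= rho by rewrite lerDr.
have arho : N1 a <= rho by rewrite lerDl.
apply: (@derive_series _ (quat R) (quat R)
  (fun k (r : quat R) => expterm s k (dpow r e k))
  a e _ (exp_coeff (4 * rho * N1 s))) => [|k|k h h1|k h h1].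
- exact: is_cvg_series_exp_coeff.
- by apply: norm_expterm (qnorm1_ddpow k rho1 arho e1) _ _; lra.
- by apply: norm_expterm (qnorm1_dpow k rho1 (qnorm1_shift a e1 h1) e1) _ _; lra.
- have [E EE Eb] := dpow_taylor k h1 (lexx rho) e1.
  by apply: norm_expterm_taylor EE Eb _ _; lra.
Qed.

(** The two differentiations under the sum are legitimate since [dpow],
    [ddpow] and the Taylor remainders grow at most geometrically in [k]. *)
Lemma fock_fueter_kernelE q p : fock_fueter_kernel q p =
  qseries (fun k => expterm (qconj p) k (lap_pow q k)).
Proof.
set s := qconj p.
set f := fun r : quat R => qseries (fun k => expterm s k (r ^+ k)).
have D i : derive (derive f ^~ (qunit i)) q (qunit i) =
    qseries (fun k => expterm s k (ddpow q (qunit i) k)).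
  have e1 : N1 (qunit i : quat R) <= 1 by rewrite qnorm1_qunit.
  have df : derive f ^~ (qunit i) =
      fun r : quat R => qseries (fun k => expterm s k (dpow r (qunit i) k)).
    by apply/funext => r; exact: (derive_expterm_pow s r e1).
  by rewrite df; exact: (derive_expterm_dpow s q e1).
rewrite /fock_fueter_kernel /laplacian (eq_bigr _ (fun i _ => D i)).
have q1 : 1 <= N1 q + 1 by rewrite lerDr qnorm1_ge0.
have cD (i : 'I_4) : cvgn (series (fun k => expterm s k (ddpow q (qunit i) k))).
  apply: (dominated_series_cvg _
    (is_cvg_series_exp_coeff (3 * (N1 q + 1) * N1 s))) => k.
  apply: norm_expterm (qnorm1_ddpow k q1 _ _) _ _; rewrite ?qnorm1_qunit ?lerDl//.
  lra.
apply/esym/cvg_lim => //.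
have -> : series (fun k => expterm s k (lap_pow q k)) =
    fun n => \sum_(i < 4) series (fun k => expterm s k (ddpow q (qunit i) k)) n.
  apply/funext => n; rewrite /series/= exchange_big; apply: eq_bigr => k _.
  rewrite /lap_pow; elim/big_rec2 : _ => [|i y1 y2 _ <-].
    by rewrite /expterm mul0r scaler0.
  by rewrite exptermD.
by apply: cvg_big => [|i _]; [exact: add_continuous|exact: cD].
Qed.

End Kernel.

(** * Integration of quaternion-valued functions *)

Lemma geometric_half_lt1 {R : realType} : `|1 / 2 : R| < 1.
Proof. by rewrite ger0_norm; lra. Qed.

Section QuaternionIntegral.
Context {R : realType} d (T : measurableType d).
Variable mu : {measure set T -> \bar R}.
Implicit Types (f g : T -> quat R).
Local Notation N1 := qnorm1.

Definition qmeasurable f :=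
  forall i, measurable_fun setT (fun x => qcoord (f x) i).

Lemma qcoordD (p q : quat R) i : qcoord (p + q) i = qcoord p i + qcoord q i.
Proof. by rewrite /qcoord mxE. Qed.

Lemma qcoordZ (a : R) (q : quat R) i : qcoord (a *: q) i = a * qcoord q i.
Proof. by rewrite /qcoord mxE. Qed.

Lemma qcoord_sum I (s : seq I) (F : I -> quat R) i :
  qcoord (\sum_(j <- s) F j) i = \sum_(j <- s) qcoord (F j) i.
Proof. by rewrite /qcoord summxE. Qed.

Lemma quat_coordE (q : quat R) : q = \sum_(i < 4) qcoord q i *: qunit i.
Proof. exact: row_sum_delta. Qed.

Lemma qcoord_linear (L : {linear quat R -> quat R}) (q : quat R) i :
  qcoord (L q) i = \sum_(j < 4) qcoord (L (qunit j)) i * qcoord q j.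
Proof.
rewrite [in LHS](quat_coordE q) linear_sum qcoord_sum.
by apply: eq_bigr => j _; rewrite linearZ qcoordZ mulrC.
Qed.

Lemma qcoord_qintegral f i :
  qcoord (qintegral mu f) i = \int[mu]_x qcoord (f x) i.
Proof. by rewrite /qcoord /qintegral mxE. Qed.

Lemma quat_coord_inj (p q : quat R) : (forall i, qcoord p i = qcoord q i) -> p = q.
Proof. by move=> h; apply/rowP. Qed.

Lemma qintegrable_dominated f (g : T -> R) : qmeasurable f ->
  (forall x, N1 (f x) <= g x) -> mu.-integrable setT (EFin \o g) ->
  qintegrable mu f.
Proof.
move=> mf fg ig i; apply: le_integrable ig => //; first exact/measurable_EFinP.
move=> x _ /=; rewrite lee_fin (le_trans (qcoord_le_qnorm1 _ _))//.
by rewrite (le_trans (fg x))// ler_norm.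
Qed.

Lemma qintegrable_sum I (s : seq I) (F : I -> T -> quat R) :
  (forall j, qintegrable mu (F j)) ->
  qintegrable mu (fun x => \sum_(j <- s) F j x).
Proof.
move=> iF i; under eq_fun do rewrite qcoord_sum -sumEFin.
by apply: integrable_sum => // j _; exact: iF.
Qed.

Lemma qintegral_sum I (s : seq I) (F : I -> T -> quat R) :
  (forall j, qintegrable mu (F j)) ->
  qintegral mu (fun x => \sum_(j <- s) F j x) = \sum_(j <- s) qintegral mu (F j).
Proof.
move=> iF; apply: quat_coord_inj => i; rewrite qcoord_sum qcoord_qintegral.
elim: s => [|j s IH].
  under eq_Rintegral do rewrite big_nil /qcoord mxE.
  by rewrite big_nil /Rintegral integral0.
rewrite big_cons -IH qcoord_qintegral -RintegralD//; last 2 first.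
- exact: iF.
- exact: qintegrable_sum.
by apply: eq_Rintegral => x _; rewrite big_cons qcoordD.
Qed.

Lemma qintegralD f g :
  qintegrable mu f -> qintegrable mu g ->
  qintegral mu (fun x => f x + g x) = qintegral mu f + qintegral mu g.
Proof.
move=> fi gi; apply: quat_coord_inj => i; rewrite qcoordD !qcoord_qintegral.
rewrite -RintegralD//; [|exact: fi|exact: gi].
by apply: eq_Rintegral => x _; rewrite qcoordD.
Qed.

(** A real-linear map of the quaternions is a constant real matrix on the
    coordinates; this covers multiplication by a constant on either side. *)
Lemma qintegrable_linear (L : {linear quat R -> quat R}) f :
  qintegrable mu f -> qintegrable mu (fun x => L (f x)).
Proof.
move=> fi i.
have -> : (fun x => (qcoord (L (f x)) i)%:E) =
    (fun x => \sum_(j < 4) (qcoord (L (qunit j)) i)%:E * (qcoord (f x) j)%:E)%E.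
  by apply/funext => x; rewrite qcoord_linear -sumEFin.
by apply: integrable_sum => // j _; apply: integrableZl => //; exact: fi.
Qed.

Lemma qintegral_linear (L : {linear quat R -> quat R}) f :
  qintegrable mu f -> qintegral mu (fun x => L (f x)) = L (qintegral mu f).
Proof.
move=> fi.
rewrite [in RHS](quat_coordE (qintegral mu f)) linear_sum.
have fi' (j : 'I_4) : qintegrable mu (fun x => qcoord (f x) j *: L (qunit j)).
  move=> i; apply: (@eq_integrable _ _ _ mu setT measurableT
      (fun x => (qcoord (L (qunit j)) i)%:E * (qcoord (f x) j)%:E)%E).
    by move=> x _; rewrite qcoordZ mulrC EFinM.
  by apply: integrableZl => //; exact: fi.
rewrite (_ : (fun x => L (f x)) =
    fun x => \sum_(j < 4) qcoord (f x) j *: L (qunit j)); last first.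
  apply/funext => x; rewrite [in LHS](quat_coordE (f x)) linear_sum.
  by apply: eq_bigr => j _; rewrite linearZ.
rewrite qintegral_sum//; apply: eq_bigr => j _.
apply: quat_coord_inj => i; rewrite linearZ qcoordZ !qcoord_qintegral.
under eq_Rintegral do rewrite qcoordZ.
by rewrite RintegralZr//; exact: fi.
Qed.

Lemma qcoord_cvg (u : nat -> quat R) (l : quat R) i :
  u @ \oo --> l -> (fun n => qcoord (u n) i) @ \oo --> qcoord l i.
Proof.
move=> ul; apply: (@cvg_comp _ _ _ u (fun q : quat R => qcoord q i) _ _ _ ul).
exact: (@coord_continuous R 1 4 ord0 i l).
Qed.

Lemma quat_cvg (u : nat -> quat R) (l : quat R) :
  (forall i, (fun n => qcoord (u n) i) @ \oo --> qcoord l i) -> u @ \oo --> l.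
Proof.
move=> ul; apply/cvgrPdist_le => e e0.
have H : \forall n \near \oo, forall i : 'I_4, `|qcoord l i - qcoord (u n) i| <= e.
  by apply: filter_forall => i; move/cvgrPdist_le : (ul i) => /(_ _ e0).
near=> n; rewrite [leLHS]/Num.Def.normr/= mx_normrE.
apply: bigmax_le => [|[i j] _ /=]; first exact: ltW.
by rewrite (ord1 i) !mxE; move: j; near: n.
Unshelve. all: by end_near. Qed.

(** Dominated convergence applied to the coordinates of the partial sums, all
    bounded by [2 * g]. *)
Lemma qintegral_qseries (F : nat -> T -> quat R) (g : T -> R) :
  (forall j, qmeasurable (F j)) ->
  (forall j x, N1 (F j x) <= (1 / 2) ^+ j * g x) ->
  mu.-integrable setT (EFin \o g) ->
  qintegrable mu (fun x => qseries (F ^~ x)) /\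
  series (fun j => qintegral mu (F j)) @ \oo -->
    qintegral mu (fun x => qseries (F ^~ x)).
Proof.
move=> mF Fg ig.
have g0 x : 0 <= g x.
  by rewrite (le_trans (qnorm1_ge0 (F 0%N x)))// (le_trans (Fg _ _))// expr0 mul1r.
have cF x : cvgn (series (F ^~ x)).
  apply: (@dominated_series_cvg _ _ _ (geometric (g x) (1 / 2))) => [j|].
    by rewrite (le_trans (norm_le_qnorm1 _))//= mulrC.
  exact/is_cvg_geometric_series/geometric_half_lt1.
have half_sum n : \sum_(0 <= j < n) (1 / 2 : R) ^+ j <= 2.
  suff -> : \sum_(0 <= j < n) (1 / 2 : R) ^+ j = 2 - 2 * (1 / 2) ^+ n.
    by rewrite gerBl mulr_ge0// exprn_ge0.
  elim: n => [|n IH]; first by rewrite big_nil expr0; ring.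
  by rewrite big_nat_recr//= IH exprS; lra.
have iF j : qintegrable mu (F j).
  apply: (@qintegrable_dominated _ (fun x => (1 / 2) ^+ j * g x)) => //.
  rewrite (_ : _ \o _ = fun x => (((1 / 2) ^+ j)%:E * (g x)%:E)%E)//.
  exact: integrableZl.
have DC i : mu.-integrable setT (fun x => (qcoord (qseries (F ^~ x)) i)%:E) /\
    (fun n => qcoord (\sum_(0 <= j < n) qintegral mu (F j)) i) @ \oo -->
      qcoord (qintegral mu (fun x => qseries (F ^~ x))) i.
  pose f_ n x := (qcoord (series (F ^~ x) n) i)%:E.
  have mf_ n : measurable_fun setT (f_ n).
    apply/measurable_EFinP; rewrite /series/=.
    under eq_fun do rewrite qcoord_sum.
    by apply: measurable_sum => j; exact: mF.
  have f_f x : f_ ^~ x @ \oo --> (qcoord (qseries (F ^~ x)) i)%:E.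
    by apply: cvg_EFin; [exact: nearW|apply: qcoord_cvg; exact: cF].
  have f_g x n : (`|f_ n x| <= 2%:E * (g x)%:E)%E.
    rewrite -EFinM lee_fin (le_trans (qcoord_le_qnorm1 _ _))//.
    rewrite /series/= (le_trans (qnorm1_sum _ _))//.
    apply: (@le_trans _ _ (\sum_(0 <= j < n) (1 / 2) ^+ j * g x)).
      by apply: ler_sum => j _; exact: Fg.
    by rewrite -mulr_suml ler_wpM2r.
  have mS := emeasurable_fun_cvg _ _ mf_ (fun x _ => f_f x).
  have ae1 : {ae mu, forall x, setT x ->
      f_ ^~ x @ \oo --> (qcoord (qseries (F ^~ x)) i)%:E}.
    by apply: aeW => x _; exact: f_f.
  have ig2 : mu.-integrable setT (fun x => 2%:E * (g x)%:E)%E.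
    exact: integrableZl.
  have ae2 : {ae mu, forall x n, setT x -> (`|f_ n x| <= 2%:E * (g x)%:E)%E}.
    by apply: aeW => x n _; exact: f_g.
  have [iS _ cs] := dominated_convergence measurableT mf_ mS ae1 ig2 ae2.
  split => //.
  rewrite qcoord_qintegral.
  have fin : (\int[mu]_x (qcoord (qseries (F ^~ x)) i)%:E)%E \is a fin_num.
    exact: integrable_fin_num.
  move: cs; rewrite -(fineK fin) => /fine_cvg; apply: cvg_trans.
  apply: near_eq_cvg; apply: nearW => n /=.
  rewrite -qintegral_sum// qcoord_qintegral.
  by congr fine.
split => [i|]; first exact: (DC i).1.
by apply: quat_cvg => i; exact: (DC i).2.
Qed.

(** The form in which orthogonality is used: if the integrals of all terms but
    one vanish, the series integrates to the remaining term. *)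
Lemma qintegral_qseries1 (F : nat -> T -> quat R) (g : T -> R) (m : nat) :
  (forall j, qmeasurable (F j)) ->
  (forall j x, N1 (F j x) <= (1 / 2) ^+ j * g x) ->
  mu.-integrable setT (EFin \o g) ->
  (forall j, j != m -> qintegral mu (F j) = 0) ->
  qintegrable mu (fun x => qseries (F ^~ x)) /\
  qintegral mu (fun x => qseries (F ^~ x)) = qintegral mu (F m).
Proof.
move=> mF Fg ig Fm; have [iS cS] := qintegral_qseries mF Fg ig; split => //.
rewrite -(cvg_lim _ cS)//; apply: cvg_lim => //.
apply: cvg_near_cst; near=> n.
have mn : (m < n)%N by near: n; exact: nbhs_infty_gt.
rewrite /series/= big_mkord (bigD1 (Ordinal mn))//= big1 ?addr0// => j jm.
exact: Fm.
Unshelve. all: by end_near. Qed.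

Lemma qseries_linear (L : {linear quat R -> quat R})
    (u : nat -> quat R) :
  cvgn (series u) -> qseries (fun k => L (u k)) = L (qseries u).
Proof.
move=> cu; apply/cvg_lim => //; apply: quat_cvg => i.
rewrite qcoord_linear (_ : (fun n => _) = fun n =>
    \sum_(j < 4) qcoord (L (qunit j)) i * qcoord (series u n) j); last first.
  by apply/funext => n; rewrite /series/= -linear_sum qcoord_linear.
apply: cvg_big => [|j _]; first exact: add_continuous.
by apply: cvgM; [exact: cvg_cst|exact: qcoord_cvg].
Qed.

End QuaternionIntegral.

(** * Integration by parts against a Gaussian bound *)

Section GaussianLine.
Context {R : realType}.
Local Notation leb := (@lebesgue_measure R).
Implicit Types (F G : R -> R) (C x y c : R).

(** The square root of the Gaussian weight: in a function of the form
    [e^(c|x|) * e^(-x^2)], one factor [bell] absorbs the exponential, up to a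
    constant, and the other remains as an integrable bound. *)
Definition bell x : R := expR (- (x ^+ 2 / 2)).

Lemma bell_gt0 x : 0 < bell x. Proof. exact: expR_gt0. Qed.
Lemma bell_ge0 x : 0 <= bell x. Proof. exact: expR_ge0. Qed.

Lemma measurable_bell : measurable_fun setT bell.
Proof.
apply: measurableT_comp => //; apply: measurable_funN.
by apply: measurable_funM => //; exact: measurable_funX.
Qed.

Lemma integrable_bell : leb.-integrable setT (EFin \o bell).
Proof.
have -> : EFin \o bell =
    (fun x => (normal_peak (1 : R))^-1%:E * (normal_pdf 0 1 x)%:E)%E.
  apply/funext => x /=; rewrite normal_pdfE ?oner_neq0// -EFinM mulKf; last first.
    by rewrite gt_eqF// normal_peak_gt0 ?oner_neq0.
  by rewrite /bell /normal_fun subr0 expr1n mulNr.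
by apply: integrableZl => //; exact: integrable_normal_pdf.
Qed.

(** The exponents compare by [c|x| <= c^2/2 + x^2/2]. *)
Lemma expR_abs_gauss c x :
  expR (c * `|x|) * expR (- x ^+ 2) <= expR (c ^+ 2 / 2) * bell x.
Proof.
rewrite -!expRD ler_expR -(real_normK (num_real x)).
have := sqr_ge0 (c - `|x|); rewrite sqrrB; lra.
Qed.

Lemma bell_nat_le (n : nat) : bell n%:R <= 2 * harmonic n.
Proof.
rewrite /bell expRN /= ler_pdivlMr// mulrC ler_pdivrMr ?expR_gt0// mulrC.
rewrite -ler_pdivrMr// (le_trans _ (expR_ge1Dx _))// -natr1.
have := sqr_ge0 ((n%:R : R) - 2^-1); rewrite sqrrB; nra.
Qed.

Lemma bell_nat_cvg : (fun n => bell n%:R) @ \oo --> (0 : R).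
Proof.
apply: (@squeeze_cvgr _ _ _ _ (cst 0) (fun n => 2 * harmonic n)).
- by apply: nearW => n; rewrite bell_ge0 bell_nat_le.
- exact: cvg_cst.
- rewrite -[X in _ --> X](mulr0 2); apply: cvgM; first exact: cvg_cst.
  exact: cvg_harmonic.
Qed.

Lemma bellN x : bell (- x) = bell x.
Proof. by rewrite /bell sqrrN. Qed.

Lemma integrable_le_bell G C : measurable_fun setT G ->
  (forall x, `|G x| <= C * bell x) -> leb.-integrable setT (EFin \o G).
Proof.
move=> mG GC; have C0 : 0 <= C.
  by rewrite -(pmulr_lge0 _ (bell_gt0 0)) (le_trans _ (GC 0)).
apply: (@le_integrable _ _ _ leb setT measurableT _
  (fun x => (C%:E * (bell x)%:E)%E)).
- exact/measurable_EFinP.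
- by move=> x _ /=; rewrite lee_fin (le_trans (GC x))// ler_norm.
by apply: integrableZl => //; exact: integrable_bell.
Qed.

(** Integration by parts without boundary terms: on [[-n, n]] the integral of
    the derivative is [F n - F (-n)], which tends to 0 with [bell n]. *)
Lemma Rintegral_derive_bell F G C :
  (forall x, is_derive x (1 : R) F (G x)) -> continuous G ->
  (forall x, `|F x| <= C * bell x) -> (forall x, `|G x| <= C * bell x) ->
  \int[leb]_x G x = 0.
Proof.
move=> dF cG FC GC.
have mG : measurable_fun setT G by exact: continuous_measurable_fun.
have iG := integrable_le_bell mG GC.
pose I (n : nat) : set R := `[- n.+1%:R, n.+1%:R]%classic.
pose f_ n := EFin \o (G \_ (I n)).
have mI n : measurable (I n) by exact: measurable_itv.
have mf_ n : measurable_fun setT (f_ n).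
  apply/measurable_EFinP/(measurable_restrictT G (mI n)).
  exact: measurable_funTS.
have mG' : measurable_fun setT (EFin \o G) by exact/measurable_EFinP.
have ae1 : {ae leb, forall x, setT x -> f_ ^~ x @ \oo --> (EFin \o G) x}.
  apply: aeW => x _; apply: cvg_near_cst.
  near=> n; rewrite /f_ /= patchE mem_set// /I /= in_itv/= -ler_norml.
  rewrite (le_trans (ltW (truncnS_gt _)))// ler_nat ltnS.
  by near: n; exact: nbhs_infty_ge.
have ae2 : {ae leb, forall x n, setT x -> (`|f_ n x| <= (abse \o (EFin \o G)) x)%E}.
  apply: aeW => x n _; rewrite /f_ /= lee_fin patchE.
  by case: ifP => // _; rewrite normr0.
have ig2 : leb.-integrable setT (abse \o (EFin \o G)) by exact: integrable_abse.
have [_ _ cs] := @dominated_convergence _ _ _ leb setT measurableT f_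
  (EFin \o G) (abse \o (EFin \o G)) mf_ mG' ae1 ig2 ae2.
have fE n : (\int[leb]_x f_ n x = (F n.+1%:R - F (- n.+1%:R))%:E)%E.
  rewrite /f_ -restrict_EFin -integral_mkcond.
  rewrite (@continuous_FTC2 _ G F)//.
  - by rewrite gtrN.
  - exact: continuous_subspaceT.
  - have cF x : {for x, continuous F}.
      exact/differentiable_continuous/derivable1_diffP.
    split; first by move=> x _.
      by apply: cvg_at_right_filter; exact: cF.
    by apply: cvg_at_left_filter; exact: cF.
  - by move=> x _; rewrite derive1E derive_val.
have fin : (\int[leb]_x (EFin \o G) x)%E \is a fin_num.
  exact: integrable_fin_num.
move: cs; rewrite -(fineK fin).
rewrite (_ : [sequence _]_n = fun n => (F n.+1%:R - F (- n.+1%:R))%:E); last first.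
  by apply/funext => n; exact: fE.
move/fine_cvg => /= cs; apply: (cvg_unique _ cs) => //=.
apply: (@squeeze_cvgr _ _ _ _ (fun n => - (2 * C * bell n.+1%:R))
  (fun n => 2 * C * bell n.+1%:R)).
- apply: nearW => n; rewrite -ler_norml (le_trans (ler_normB _ _))//.
  rewrite -mulrA mulr2n mulrDl !mul1r lerD//.
  by rewrite (le_trans (FC _))// bellN.
- rewrite -oppr0; apply: cvgN.
  rewrite -[X in _ --> X](mulr0 (2 * C)); apply: cvgM; first exact: cvg_cst.
  by rewrite (cvg_shiftS (fun n => bell n%:R)); exact: bell_nat_cvg.
- rewrite -[X in _ --> X](mulr0 (2 * C)); apply: cvgM; first exact: cvg_cst.
  by rewrite (cvg_shiftS (fun n => bell n%:R)); exact: bell_nat_cvg.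
Unshelve. all: by end_near. Qed.

End GaussianLine.

Section GaussianPlane.
Context {R : realType}.
Local Notation leb := (@lebesgue_measure R).
Local Notation leb2 := (@lebesgue2 R).
Implicit Types (F G : R * R -> R) (C x y c : R).

Lemma measurable_bell2 :
  measurable_fun setT (fun z : R * R => bell z.1 * bell z.2).
Proof.
by apply: measurable_funM; apply: measurableT_comp => //; exact: measurable_bell.
Qed.

Lemma integrable_bell2 :
  leb2.-integrable setT (fun z : R * R => (bell z.1 * bell z.2)%:E).
Proof.
apply/integrable12ltyP; first by apply/measurable_EFinP; exact: measurable_bell2.
pose b := (\int[leb]_x bell x)%R.
have bE : (\int[leb]_x (bell x)%:E = b%:E)%E.
  by rewrite /b fineK//; apply: integrable_fin_num => //; exact: integrable_bell.
under eq_integral => x _.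
  under eq_integral => y _ do
    rewrite /= ger0_norm ?mulr_ge0 ?bell_ge0// EFinM.
  rewrite integralZl//; last exact: integrable_bell.
  rewrite bE muleC.
  over.
rewrite integralZl//; last exact: integrable_bell.
by rewrite bE -EFinM ltry.
Qed.

Lemma integrable_le_bell2 G C : measurable_fun setT G ->
  (forall z, `|G z| <= C * (bell z.1 * bell z.2)) ->
  leb2.-integrable setT (EFin \o G).
Proof.
move=> mG GC.
apply: (@le_integrable _ _ _ leb2 setT measurableT _
  (fun z => (C%:E * (bell z.1 * bell z.2)%:E)%E)).
- exact/measurable_EFinP.
- by move=> x _ /=; rewrite lee_fin (le_trans (GC x))// ler_norm.
by apply: integrableZl => //; exact: integrable_bell2.
Qed.

(** By Fubini, as the inner integral vanishes for every value of the other
    variable. *)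
Lemma Rintegral_derive_fst F G C : measurable_fun setT G ->
  (forall x y, is_derive x (1 : R) (fun s => F (s, y)) (G (x, y))) ->
  (forall y, continuous (fun x => G (x, y))) ->
  (forall z, `|F z| <= C * (bell z.1 * bell z.2)) ->
  (forall z, `|G z| <= C * (bell z.1 * bell z.2)) ->
  \int[leb2]_z G z = 0.
Proof.
move=> mG dF cG FC GC; have iG := integrable_le_bell2 mG GC.
rewrite /Rintegral -integral21_prod_meas1//.
rewrite (_ : fubini_G _ _ = cst 0%E); first by rewrite integral0.
apply/funext => y; rewrite /fubini_G /=.
have GCy x : `|G (x, y)| <= C * bell y * bell x.
  by rewrite (le_trans (GC _))//= -mulrA (mulrC (bell y)).
have iGy : leb.-integrable setT (EFin \o (fun x => G (x, y))).
  by apply: integrable_le_bell GCy; exact: continuous_measurable_fun.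
rewrite -[LHS]fineK; last exact: integrable_fin_num.
congr (_%:E); apply: (Rintegral_derive_bell (dF ^~ y) (cG y) _ GCy) => x.
by rewrite (le_trans (FC _))//= -mulrA (mulrC (bell y)).
Qed.

Lemma Rintegral_derive_snd F G C : measurable_fun setT G ->
  (forall x y, is_derive y (1 : R) (fun s => F (x, s)) (G (x, y))) ->
  (forall x, continuous (fun y => G (x, y))) ->
  (forall z, `|F z| <= C * (bell z.1 * bell z.2)) ->
  (forall z, `|G z| <= C * (bell z.1 * bell z.2)) ->
  \int[leb2]_z G z = 0.
Proof.
move=> mG dF cG FC GC; have iG := integrable_le_bell2 mG GC.
rewrite /Rintegral -integral12_prod_meas1//.
rewrite (_ : fubini_F _ _ = cst 0%E); first by rewrite integral0.
apply/funext => x; rewrite /fubini_F /=.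
have GCx y : `|G (x, y)| <= C * bell x * bell y.
  by rewrite (le_trans (GC _))//= -mulrA.
have iGx : leb.-integrable setT (EFin \o (fun y => G (x, y))).
  by apply: integrable_le_bell GCx; exact: continuous_measurable_fun.
rewrite -[LHS]fineK; last exact: integrable_fin_num.
congr (_%:E); apply: (Rintegral_derive_bell (dF x) (cG x) _ GCx) => y.
by rewrite (le_trans (FC _))//= -mulrA.
Qed.

(** The square of the one-dimensional Gaussian integral. *)
Lemma Rintegral_gauss2 :
  \int[leb2]_z (expR (- (z.1 ^+ 2 + z.2 ^+ 2))) = pi.
Proof.
rewrite /Rintegral fubini_tonelli1; last 2 first.
- apply/measurable_EFinP; apply: measurableT_comp => //.
  apply: measurable_funN; apply: measurable_funD; exact: measurable_funX.
- by move=> z; rewrite lee_fin expR_ge0.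
under eq_integral => x _.
  rewrite /fubini_F /=.
  under eq_integral => y _ do rewrite opprD expRD EFinM.
  rewrite integralZl//; last exact: integrableT_gauss.
  rewrite integralT_gauss muleC.
  over.
rewrite integralZl//; last exact: integrableT_gauss.
by rewrite integralT_gauss -EFinM /= -expr2 sqr_sqrtr ?pi_ge0.
Qed.

End GaussianPlane.

(** * Differentiation of quaternion-valued functions of a real variable *)

(** Naming this map gives it a canonical linear structure, which serves for
    left, right and scalar multiplications at once. *)
Definition qsandwich {R : realType} (l r x : quat R) : quat R := l * x * r.

Section QSandwich.
Context {R : realType} (l r : quat R).

Fact qsandwich_linear : linear (qsandwich l r).
Proof.
by move=> a x y; rewrite /qsandwich mulrDr mulrDl -scalerAr -scalerAl.
Qed.

HB.instance Definition _ :=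
  GRing.isLinear.Build R (quat R) (quat R) *:%R (qsandwich l r) qsandwich_linear.

End QSandwich.

Section QDerivative.
Context {R : realType}.
Implicit Types (f g : R -> quat R) (a : R -> R) (t : R) (v w : quat R).

(** Differentiation is coordinatewise, as the product rule has to keep track of
    the order of the factors. *)
Definition qderive_at f t v :=
  forall i, is_derive t (1 : R) (fun s => qcoord (f s) i) (qcoord v i).

Lemma qderive_atM f g t v w : qderive_at f t v -> qderive_at g t w ->
  qderive_at (fun s => f s * g s) t (v * g t + f t * w).
Proof.
move=> df dg.
have f0 : is_derive t (1 : R) (fun s => qre (f s)) (qre v) := df (inord 0).
have f1 : is_derive t (1 : R) (fun s => qi (f s)) (qi v) := df (inord 1).
have f2 : is_derive t (1 : R) (fun s => qj (f s)) (qj v) := df (inord 2).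
have f3 : is_derive t (1 : R) (fun s => qk (f s)) (qk v) := df (inord 3).
have g0 : is_derive t (1 : R) (fun s => qre (g s)) (qre w) := dg (inord 0).
have g1 : is_derive t (1 : R) (fun s => qi (g s)) (qi w) := dg (inord 1).
have g2 : is_derive t (1 : R) (fun s => qj (g s)) (qj w) := dg (inord 2).
have g3 : is_derive t (1 : R) (fun s => qk (g s)) (qk w) := dg (inord 3).
apply: qcoordP.
- have -> : (fun s => qcoord (f s * g s) (inord 0)) = (fun s =>
      qre (f s) * qre (g s) - qi (f s) * qi (g s) -
      qj (f s) * qj (g s) - qk (f s) * qk (g s)).
    by apply/funext => s; rewrite -[qcoord _ _]/(qre _) quatE.
  apply: is_derive_eq; rewrite -[qcoord _ (inord 0)]/(qre _) !quatE /GRing.scale/=.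
  ring.
- have -> : (fun s => qcoord (f s * g s) (inord 1)) = (fun s =>
      qre (f s) * qi (g s) + qi (f s) * qre (g s) +
      qj (f s) * qk (g s) - qk (f s) * qj (g s)).
    by apply/funext => s; rewrite -[qcoord _ _]/(qi _) quatE.
  apply: is_derive_eq; rewrite -[qcoord _ (inord 1)]/(qi _) !quatE /GRing.scale/=.
  ring.
- have -> : (fun s => qcoord (f s * g s) (inord 2)) = (fun s =>
      qre (f s) * qj (g s) - qi (f s) * qk (g s) +
      qj (f s) * qre (g s) + qk (f s) * qi (g s)).
    by apply/funext => s; rewrite -[qcoord _ _]/(qj _) quatE.
  apply: is_derive_eq; rewrite -[qcoord _ (inord 2)]/(qj _) !quatE /GRing.scale/=.
  ring.
- have -> : (fun s => qcoord (f s * g s) (inord 3)) = (fun s =>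
      qre (f s) * qk (g s) + qi (f s) * qj (g s) -
      qj (f s) * qi (g s) + qk (f s) * qre (g s)).
    by apply/funext => s; rewrite -[qcoord _ _]/(qk _) quatE.
  apply: is_derive_eq; rewrite -[qcoord _ (inord 3)]/(qk _) !quatE /GRing.scale/=.
  ring.
Qed.

Lemma qderive_atX f t v n : GRing.comm (f t) v -> qderive_at f t v ->
  qderive_at (fun s => f s ^+ n) t (n%:R *: (f t ^+ n.-1 * v)).
Proof.
move=> cfv df; elim: n => [|n IH].
  rewrite scale0r => i; rewrite (_ : (fun s => _) = cst (qcoord 1 i)).
    have -> : qcoord (0 : quat R) i = 0 by rewrite /qcoord mxE.
    exact: is_derive_cst.
  by apply/funext => s; rewrite expr0.
have -> : (fun s => f s ^+ n.+1) = (fun s => f s ^+ n * f s).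
  by apply/funext => s; rewrite exprSr.
suff -> : n.+1%:R *: (f t ^+ n.+1.-1 * v) =
    n%:R *: (f t ^+ n.-1 * v) * f t + f t ^+ n * v by exact: qderive_atM.
rewrite -natr1 scalerDl scale1r; congr (_ + _).
rewrite -scalerAl -mulrA -cfv mulrA; case: n {IH} => [|n /=].
  by rewrite !scale0r.
by rewrite exprSr.
Qed.

Lemma qderive_atZ a f t (da : R) v : is_derive t (1 : R) a da ->
  qderive_at f t v ->
  qderive_at (fun s => a s *: f s) t (da *: f t + a t *: v).
Proof.
move=> a' df i; have fi := df i.
have -> : (fun s => qcoord (a s *: f s) i) = (fun s => a s * qcoord (f s) i).
  by apply/funext => s; rewrite qcoordZ.
by apply: is_derive_eq; rewrite qcoordD !qcoordZ /GRing.scale/= addrC mulrC.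
Qed.

Lemma qderive_at_continuous f t v i : qderive_at f t v ->
  {for t, continuous (fun s => qcoord (f s) i)}.
Proof.
by move=> df; have fi := df i; apply/differentiable_continuous/derivable1_diffP.
Qed.

End QDerivative.

(** * Measurability and regularity of quaternion-valued functions *)

Section QMeasurable.
Context {R : realType} d (T : measurableType d).
Implicit Types (f g : T -> quat R).

Lemma qmeasurable_linear (L : {linear quat R -> quat R}) f :
  qmeasurable f -> qmeasurable (fun x => L (f x)).
Proof.
move=> mf i.
under eq_fun do rewrite qcoord_linear.
by apply: measurable_sum => j; apply: measurable_funM => //; exact: mf.
Qed.

Lemma qmeasurableD f g : qmeasurable f -> qmeasurable g ->
  qmeasurable (fun x => f x + g x).
Proof.
move=> mf mg i; under eq_fun do rewrite qcoordD.
by apply: measurable_funD; [exact: mf|exact: mg].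
Qed.

Lemma qmeasurableZ (a : T -> R) f : measurable_fun setT a -> qmeasurable f ->
  qmeasurable (fun x => a x *: f x).
Proof.
move=> ma mf i; under eq_fun do rewrite qcoordZ.
by apply: measurable_funM => //; exact: mf.
Qed.

Lemma qmeasurable_cst (q : quat R) : qmeasurable (fun _ : T => q).
Proof. by move=> i; exact: measurable_cst. Qed.

Lemma qmeasurableM f g : qmeasurable f -> qmeasurable g ->
  qmeasurable (fun x => f x * g x).
Proof.
move=> mf mg i.
have -> : (fun x => qcoord (f x * g x) i) =
    (fun x => \sum_(j < 4) qcoord (f x) j * qcoord (qunit j * g x) i).
  apply/funext => x; rewrite [in LHS](quat_coordE (f x)) mulr_suml qcoord_sum.
  by apply: eq_bigr => j _; rewrite -scalerAl qcoordZ.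
apply: measurable_sum => j; apply: measurable_funM; first exact: mf.
have -> : (fun x => qcoord (qunit j * g x) i) =
    (fun x => qcoord (qsandwich (qunit j) 1 (g x)) i).
  by apply/funext => x; rewrite /qsandwich mulr1.
exact: qmeasurable_linear.
Qed.

Lemma qmeasurableX f n : qmeasurable f -> qmeasurable (fun x => f x ^+ n).
Proof.
move=> mf; elim: n => [|n IH].
  by under eq_fun do rewrite expr0; exact: qmeasurable_cst.
by under eq_fun do rewrite exprS; exact: qmeasurableM.
Qed.

End QMeasurable.

(** A single term of the exponential series; it turns every polynomial bound
    below into an exponential one. *)
Lemma powX_le_expR {R : realType} (r : R) n : 0 <= r -> r ^+ n <= n`!%:R * expR r.
Proof.
move=> r0; rewrite -ler_pdivrMl ?ltr0n ?fact_gt0// mulrC.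
case: n => [|n].
  by rewrite expr0 fact0 divr1 -expR0 ler_expR.
by apply: le_trans (expR_ge1Dxn n r0); rewrite lerDr.
Qed.

Section RegularFunctions.
Context {R : realType}.
Local Notation leb2 := (@lebesgue2 R).
Implicit Types (f g : R * R -> quat R).

Definition bell2 (z : R * R) : R := bell z.1 * bell z.2.

Lemma bell2_ge0 z : 0 <= bell2 z.
Proof. by rewrite mulr_ge0// bell_ge0. Qed.

(** Functions whose partial integrals can be computed by parts. The class is
    stable under real-linear combinations and under multiplication by constant
    quaternions, which is all that the moment recurrences require. *)
Record bell_regular f : Prop := BellRegular {
  breg_meas : qmeasurable f;
  breg_fst : forall y i, continuous (fun x => qcoord (f (x, y)) i);
  breg_snd : forall x i, continuous (fun y => qcoord (f (x, y)) i);
  breg_le : exists C, forall z, qnorm1 (f z) <= C * bell2 z }.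

Lemma bell_regularD f g : bell_regular f -> bell_regular g ->
  bell_regular (fun z => f z + g z).
Proof.
move=> [mf f1 f2 [C fC]] [mg g1 g2 [D gD]]; split.
- exact: qmeasurableD.
- move=> y i x; under eq_fun do rewrite qcoordD.
  by apply: cvgD; [exact: f1|exact: g1].
- move=> x i y; under eq_fun do rewrite qcoordD.
  by apply: cvgD; [exact: f2|exact: g2].
- exists (C + D) => z; rewrite mulrDl (le_trans (qnorm1D _ _))//.
  exact: lerD.
Qed.

Lemma continuous_linear (L : {linear quat R -> quat R}) (h : R -> quat R) :
  (forall i, continuous (fun s => qcoord (h s) i)) ->
  forall i, continuous (fun s => qcoord (L (h s)) i).
Proof.
move=> ch i.
under eq_fun do rewrite qcoord_linear.
move=> s; apply: cvg_big => [|j _]; first exact: add_continuous.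
by apply: cvgM; [exact: cvg_cst|exact: ch].
Qed.

Lemma bell_regular_sandwich f l r : bell_regular f ->
  bell_regular (fun z => l * f z * r).
Proof.
move=> [mf f1 f2 [C fC]]; split.
- exact: (qmeasurable_linear (qsandwich l r)).
- by move=> y; exact: (continuous_linear (L := qsandwich l r)).
- by move=> x; exact: (continuous_linear (L := qsandwich l r)).
- exists (qnorm1 l * C * qnorm1 r) => z.
  have := qnorm1M_le (qnorm1M_le (lexx (qnorm1 l)) (fC z)) (lexx (qnorm1 r)).
  by move=> /le_trans; apply; rewrite le_eqVlt; apply/orP; left; apply/eqP; ring.
Qed.

Lemma bell_regularZ f (a : R) : bell_regular f ->
  bell_regular (fun z => a *: f z).
Proof.
move=> /(bell_regular_sandwich (a *: 1) 1).
by under eq_fun do rewrite mulr1 -scalerAl mul1r.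
Qed.

Lemma bell_regularN f : bell_regular f -> bell_regular (fun z => - f z).
Proof. by move=> /(bell_regularZ (-1)); under eq_fun do rewrite scaleN1r. Qed.

Lemma bell_regular_integrable f : bell_regular f -> qintegrable leb2 f.
Proof.
move=> [mf _ _ [C fC]]; 
apply: (@qintegrable_dominated R _ _ leb2 f (fun z => C * bell2 z) mf fC).
rewrite (_ : _ \o _ = fun z => (C%:E * (bell2 z)%:E)%E)//.
by apply: integrableZl => //; exact: integrable_bell2.
Qed.

Lemma qintegral_derive_fst f g : bell_regular f -> bell_regular g ->
  (forall x y, qderive_at (fun s => f (s, y)) x (g (x, y))) ->
  qintegral leb2 g = 0.
Proof.
move=> [mf f1 f2 [C fC]] [mg g1 g2 [D gD]] fg.
apply: quat_coord_inj => i; rewrite qcoord_qintegral [RHS]mxE.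
apply: (@Rintegral_derive_fst _ (fun z => qcoord (f z) i)
  (fun z => qcoord (g z) i) (Num.max C D)) => //.
- by move=> x y; exact: fg.
- move=> z /=; rewrite (le_trans (qcoord_le_qnorm1 _ _))// (le_trans (fC z))//.
  by rewrite ler_wpM2r ?bell2_ge0// le_max lexx.
- move=> z /=; rewrite (le_trans (qcoord_le_qnorm1 _ _))// (le_trans (gD z))//.
  by rewrite ler_wpM2r ?bell2_ge0// le_max lexx orbT.
Qed.

Lemma qintegral_derive_snd f g : bell_regular f -> bell_regular g ->
  (forall x y, qderive_at (fun s => f (x, s)) y (g (x, y))) ->
  qintegral leb2 g = 0.
Proof.
move=> [mf f1 f2 [C fC]] [mg g1 g2 [D gD]] fg.
apply: quat_coord_inj => i; rewrite qcoord_qintegral [RHS]mxE.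
apply: (@Rintegral_derive_snd _ (fun z => qcoord (f z) i)
  (fun z => qcoord (g z) i) (Num.max C D)) => //.
- by move=> x y; exact: fg.
- move=> z /=; rewrite (le_trans (qcoord_le_qnorm1 _ _))// (le_trans (fC z))//.
  by rewrite ler_wpM2r ?bell2_ge0// le_max lexx.
- move=> z /=; rewrite (le_trans (qcoord_le_qnorm1 _ _))// (le_trans (gD z))//.
  by rewrite ler_wpM2r ?bell2_ge0// le_max lexx orbT.
Qed.

End RegularFunctions.

(** * Gaussian moments on a complex slice *)

Section SliceGeometry.
Context {R : realType} (I : quat R) (hI : imag_units I).
Local Notation leb2 := (@lebesgue2 R).
Local Notation N1 := qnorm1.
Implicit Types (z : R * R) (m n : nat).

(** The coordinates of [I * I = -1] along the imaginary units say that [2 qre I]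
    kills the imaginary part; a nonzero real part would thus make [I] real,
    with a nonnegative square. *)
Lemma imag_unit_coord : qre I = 0 /\ qi I ^+ 2 + qj I ^+ 2 + qk I ^+ 2 = 1.
Proof.
have II : I * I = -1 by rewrite -expr2; exact: hI.
have := congr1 qre II; have := congr1 qi II; have := congr1 qj II.
have := congr1 qk II; rewrite !quatE !oppr0 => k0 j0 i0 r0.
have re0 : qre I = 0.
  have [//|re0] := eqVneq (qre I) 0.
  have H x : qre I * x + x * qre I = 0 -> x = 0.
    move=> h; have /eqP : qre I * x = 0 by lra.
    by rewrite mulf_eq0 (negbTE re0) => /eqP.
  have qi0 : qi I = 0 by apply: H; lra.
  have qj0 : qj I = 0 by apply: H; lra.
  have qk0 : qk I = 0 by apply: H; lra.
  have := sqr_ge0 (qre I); move: r0; rewrite qi0 qj0 qk0; nra.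
by split => //; move: r0; rewrite re0; lra.
Qed.

Lemma sliceE z : ((qre (slice I z) = z.1) * (qi (slice I z) = (z.2 * qi I)%R) *
  (qj (slice I z) = (z.2 * qj I)%R) * (qk (slice I z) = (z.2 * qk I)%R))%type.
Proof.
have [r0 _] := imag_unit_coord.
by rewrite /slice !quatE r0 !mulr0 mulr1 !addr0 !add0r.
Qed.

Lemma qmod_slice z : qmod (slice I z) ^+ 2 = z.1 ^+ 2 + z.2 ^+ 2.
Proof.
have [_ s1] := imag_unit_coord.
rewrite /qmod sqr_sqrtr ?sumr_ge0// => [|i _]; last exact: sqr_ge0.
rewrite sum_qcoord -!/(qre _) -!/(qi _) -!/(qj _) -!/(qk _) !sliceE !exprMn.
by rewrite -!addrA -!mulrDr addrA s1 mulr1.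
Qed.

Lemma comm_slice z : GRing.comm (slice I z) I.
Proof.
by rewrite /GRing.comm /slice mulrDl mulrDr -!scalerAl -!scalerAr mul1r mulr1.
Qed.

Lemma conj_slice z : qconj (slice I z) = slice I (z.1, - z.2).
Proof. by apply: quatP; rewrite quatE !sliceE ?mulNr. Qed.

Definition gauss2 z : R := expR (- (z.1 ^+ 2 + z.2 ^+ 2)).

(** Up to the factor [pi^-1], the integrand of the Gaussian inner product of
    [p ^ m] and [p ^ n] on the slice. *)
Definition gmoment m n z : quat R :=
  gauss2 z *: (qconj (slice I z) ^+ m * slice I z ^+ n).

Lemma gauss2_exp_le c z :
  expR (c * (`|z.1| + `|z.2|)) * gauss2 z <= expR (c ^+ 2 / 2) ^+ 2 * bell2 z.
Proof.
rewrite /gauss2 mulrDr opprD !expRD mulrACA /bell2.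
rewrite [expR (c ^+ 2 / 2) ^+ 2]expr2 [leRHS]mulrACA.
by apply: ler_pM; rewrite ?mulr_ge0 ?expR_ge0//; exact: expR_abs_gauss.
Qed.

Definition slice_const : R := 1 + N1 I.

Lemma qnorm1_slice z : N1 (slice I z) <= slice_const * (`|z.1| + `|z.2|).
Proof.
rewrite (le_trans (qnorm1D _ _))// !qnorm1Z qnorm1_1 /slice_const.
have := qnorm1_ge0 I; have := normr_ge0 z.1; have := normr_ge0 z.2; nra.
Qed.

Lemma qnorm1_gmoment m n z : N1 (gmoment m n z) <=
  (slice_const * (`|z.1| + `|z.2|)) ^+ (m + n) * gauss2 z.
Proof.
rewrite qnorm1Z ger0_norm ?expR_ge0// mulrC ler_wpM2r ?expR_ge0// exprD.
have b0 : 0 <= slice_const * (`|z.1| + `|z.2|).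
  by rewrite mulr_ge0 ?addr_ge0 ?qnorm1_ge0.
by apply: qnorm1M_le; rewrite (le_trans (qnorm1X _ _))// lerXn2r ?nnegrE
  ?qnorm1_ge0 ?qnorm1_conj ?qnorm1_slice.
Qed.

Lemma measurable_gauss2 : measurable_fun setT gauss2.
Proof.
apply: measurableT_comp => //; apply: measurable_funN.
by apply: measurable_funD; exact: measurable_funX.
Qed.

Lemma qmeasurable_slice : qmeasurable (slice I).
Proof.
by apply: qmeasurableD; apply: qmeasurableZ => //; exact: qmeasurable_cst.
Qed.

Lemma qmeasurable_gmoment m n : qmeasurable (gmoment m n).
Proof.
apply: qmeasurableZ; first exact: measurable_gauss2.
apply: qmeasurableM; apply: qmeasurableX; last exact: qmeasurable_slice.
rewrite (_ : (fun x => _) = fun z => z.1%:A + (- z.2) *: I); last first.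
  by apply/funext => z; rewrite conj_slice.
apply: qmeasurableD; apply: qmeasurableZ => //; try exact: qmeasurable_cst.
exact: measurable_funN.
Qed.

Lemma qderive_slice_fst x y : qderive_at (fun s => slice I (s, y)) x 1.
Proof.
move=> i; rewrite (_ : (fun s => _) =
    fun s => s * qcoord 1 i + y * qcoord I i); last first.
  by apply/funext => s; rewrite /slice/= qcoordD !qcoordZ.
by apply: is_derive_eq; rewrite /GRing.scale/=; ring.
Qed.

Lemma qderive_slice_snd x y : qderive_at (fun s => slice I (x, s)) y I.
Proof.
move=> i; rewrite (_ : (fun s => _) =
    fun s => x * qcoord 1 i + s * qcoord I i); last first.
  by apply/funext => s; rewrite /slice/= qcoordD !qcoordZ.
by apply: is_derive_eq; rewrite /GRing.scale/=; ring.
Qed.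

Lemma qderive_at_conj (f : R -> quat R) t v : qderive_at f t v ->
  qderive_at (fun s => qconj (f s)) t (qconj v).
Proof.
move=> df.
have d0 : is_derive t (1 : R) (fun s => qre (f s)) (qre v) := df (inord 0).
have d1 : is_derive t (1 : R) (fun s => qi (f s)) (qi v) := df (inord 1).
have d2 : is_derive t (1 : R) (fun s => qj (f s)) (qj v) := df (inord 2).
have d3 : is_derive t (1 : R) (fun s => qk (f s)) (qk v) := df (inord 3).
apply: qcoordP.
- rewrite -[qcoord _ _]/(qre _) quatE.
  by under eq_fun do rewrite -[qcoord _ _]/(qre _) quatE.
- rewrite -[qcoord _ _]/(qi _) quatE.
  by under eq_fun do rewrite -[qcoord _ _]/(qi _) quatE; exact: is_deriveN.
- rewrite -[qcoord _ _]/(qj _) quatE.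
  by under eq_fun do rewrite -[qcoord _ _]/(qj _) quatE; exact: is_deriveN.
- rewrite -[qcoord _ _]/(qk _) quatE.
  by under eq_fun do rewrite -[qcoord _ _]/(qk _) quatE; exact: is_deriveN.
Qed.

End SliceGeometry.

Section GaussianMonomials.
Context {R : realType} (I : quat R) (hI : imag_units I).
Local Notation leb2 := (@lebesgue2 R).
Local Notation N1 := qnorm1.
Implicit Types (z : R * R) (m n : nat).
Local Notation T := (gmoment I).

Lemma is_derive_gauss2_fst x y :
  is_derive x (1 : R) (fun s : R => gauss2 (s, y)) (- (2 * x) * gauss2 (x, y)).
Proof.
rewrite /gauss2/=; apply: is_derive_eq.
rewrite /GRing.scale/=; ring.
Qed.

Lemma is_derive_gauss2_snd x y :
  is_derive y (1 : R) (fun s : R => gauss2 (x, s)) (- (2 * y) * gauss2 (x, y)).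
Proof.
rewrite /gauss2/=; apply: is_derive_eq.
rewrite /GRing.scale/=; ring.
Qed.

(** The derivatives of [gmoment I m n] with respect to [p = slice I z] and to
    its conjugate, the weight being [exp (- p * conj p)]. For [n = 0] or
    [m = 0] the predecessor is harmless, its coefficient being 0. *)
Definition wirtinger m n z : quat R := n%:R *: T m n.-1 z - T m.+1 n z.
Definition wirtinger_conj m n z : quat R := m%:R *: T m.-1 n z - T m n.+1 z.

Lemma conj_imag : qconj I = - I.
Proof.
have [r0 _] := imag_unit_coord hI.
by apply: quatP; rewrite !quatE ?r0 ?oppr0.
Qed.

Lemma slice_addconj z : slice I z + qconj (slice I z) = (2 * z.1) *: 1.
Proof.
rewrite (conj_slice hI) /slice/= addrACA -scalerDl -scalerDl subrr scale0r.
by rewrite addr0 mulr_natl.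
Qed.

Lemma slice_subconj z : (slice I z - qconj (slice I z)) * I = (- (2 * z.2)) *: 1.
Proof.
rewrite (conj_slice hI) /slice/= opprD addrACA -scaleNr -scalerDl subrr scale0r.
rewrite add0r -scalerBl opprK -scalerAl -expr2 hI scalerN scaleNr.
by rewrite mulr_natl.
Qed.

Lemma qderive_gmoment_fst m n x y : qderive_at (fun s => T m n (s, y)) x
  (wirtinger m n (x, y) + wirtinger_conj m n (x, y)).
Proof.
set p := slice I (x, y); set A := qconj p ^+ m; set B := p ^+ n.
set g := gauss2 (x, y).
suff <- : (- (2 * x) * g) *: (A * B) + g *:
    ((m%:R *: (qconj p ^+ m.-1 * qconj 1)) * B + A * (n%:R *: (p ^+ n.-1 * 1))) =
    wirtinger m n (x, y) + wirtinger_conj m n (x, y).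
  apply: qderive_atZ; first exact: is_derive_gauss2_fst.
  have d1 := qderive_slice_fst I x y.
  apply: qderive_atM; last by apply: qderive_atX => //; exact: commr1.
  apply: (qderive_atX (f := fun s => qconj (slice I (s, y)))).
    by rewrite /GRing.comm -!qconjM mulr1 mul1r.
  exact: qderive_at_conj.
have -> : qconj 1 = 1 :> quat R by apply: quatP; rewrite !quatE ?oppr0.
rewrite /wirtinger /wirtinger_conj /gmoment -/p -/g -/A -/B !mulr1.
have xE : (2 * x) *: (A * B) = qconj p ^+ m.+1 * B + A * p ^+ n.+1.
  rewrite (exprSr (qconj p) m) (exprS p n) (mulrA A p B) -mulrDl -mulrDr.
  by rewrite [qconj p + p]addrC slice_addconj/= -scalerAr mulr1 scalerAl.
rewrite mulNr mulrC -mulrN -scalerA scaleNr xE -scalerAl -scalerAr.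
move: (qconj p ^+ m.+1 * B) (A * p ^+ n.+1) (qconj p ^+ m.-1 * B)
  (A * p ^+ n.-1) => a b c d.
by apply: quatP; rewrite !quatE; ring.
Qed.

Lemma qderive_gmoment_snd m n x y : qderive_at (fun s => T m n (x, s)) y
  ((wirtinger m n (x, y) - wirtinger_conj m n (x, y)) * I).
Proof.
set p := slice I (x, y); set A := qconj p ^+ m; set B := p ^+ n.
set g := gauss2 (x, y).
have cIp k : I * p ^+ k = p ^+ k * I.
  exact/commrX/commr_sym/comm_slice.
have cpI : GRing.comm (qconj p) (qconj I).
  by rewrite /GRing.comm -!qconjM (comm_slice I).
suff <- : (- (2 * y) * g) *: (A * B) + g *:
    ((m%:R *: (qconj p ^+ m.-1 * qconj I)) * B + A * (n%:R *: (p ^+ n.-1 * I))) =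
    (wirtinger m n (x, y) - wirtinger_conj m n (x, y)) * I.
  apply: qderive_atZ; first exact: is_derive_gauss2_snd.
  have d1 := qderive_slice_snd I x y.
  apply: qderive_atM; last by apply: qderive_atX => //; exact: comm_slice.
  apply: (qderive_atX (f := fun s => qconj (slice I (x, s)))) => //.
  exact: qderive_at_conj.
rewrite conj_imag /wirtinger /wirtinger_conj /gmoment -/p -/g -/A -/B.
have yE : (- (2 * y)) *: (A * B) = (A * p ^+ n.+1 - qconj p ^+ m.+1 * B) * I.
  rewrite (exprSr (qconj p) m) (exprS p n) (mulrA A p B) -mulrBl -mulrBr.
  rewrite -!mulrA -[B * I]cIp [(p - _) * _]mulrA slice_subconj/=.
  by rewrite -scalerAl mul1r -scalerAr.
rewrite [_ * g]mulrC -scalerA yE -[m%:R *: _ * B]scalerAl.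
have -> : qconj p ^+ m.-1 * - I * B = - (qconj p ^+ m.-1 * B * I).
  by rewrite mulrN mulNr -!mulrA cIp.
have -> : A * (n%:R *: (p ^+ n.-1 * I)) = n%:R *: (A * p ^+ n.-1 * I).
  by rewrite -scalerAr mulrA.
move: (qconj p ^+ m.+1 * B) (A * p ^+ n.+1) (qconj p ^+ m.-1 * B)
  (A * p ^+ n.-1) => a b c d.
by apply: quatP; rewrite !quatE; ring.
Qed.

Lemma bell_regular_gmoment m n : bell_regular (T m n).
Proof.
split.
- exact: qmeasurable_gmoment.
- move=> y i x; apply: qderive_at_continuous (qderive_gmoment_fst m n x y).
- move=> x i y; apply: qderive_at_continuous (qderive_gmoment_snd m n x y).
- exists ((m + n)`!%:R * expR (slice_const I ^+ 2 / 2) ^+ 2) => z.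
  rewrite (le_trans (qnorm1_gmoment I m n z))// -mulrA.
  have r0 : 0 <= slice_const I * (`|z.1| + `|z.2|).
    by rewrite mulr_ge0 ?addr_ge0 ?qnorm1_ge0.
  have := gauss2_exp_le (slice_const I) z.
  move=> /(ler_wpM2l (ler0n R (m + n)`!)); apply: le_trans.
  by rewrite mulrA ler_wpM2r ?expR_ge0// powX_le_expR.
Qed.

Lemma bell_regular_wirtinger m n : bell_regular (wirtinger m n).
Proof.
apply: bell_regularD; last by apply: bell_regularN; exact: bell_regular_gmoment.
by apply: bell_regularZ; exact: bell_regular_gmoment.
Qed.

Lemma bell_regular_wirtinger_conj m n : bell_regular (wirtinger_conj m n).
Proof.
apply: bell_regularD; last by apply: bell_regularN; exact: bell_regular_gmoment.
by apply: bell_regularZ; exact: bell_regular_gmoment.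
Qed.

End GaussianMonomials.

Section GaussianMoments.
Context {R : realType} (I : quat R) (hI : imag_units I).
Local Notation leb2 := (@lebesgue2 R).
Local Notation N1 := qnorm1.
Implicit Types (z : R * R) (m n : nat).
Local Notation T := (gmoment I).

Definition gauss_moment m n := qintegral leb2 (T m n).

(** The partial derivatives of [gmoment] are [w + w'] in [x] and [(w - w') * I]
    in [y], where [w], [w'] are the Wirtinger derivatives. Both have integral 0,
    and [I] is invertible. *)
Lemma qintegral_wirtinger_eq0 m n :
  qintegral leb2 (wirtinger I m n) = 0 /\ qintegral leb2 (wirtinger_conj I m n) = 0.
Proof.
have rW := bell_regular_wirtinger hI m n.
have rV := bell_regular_wirtinger_conj hI m n.
have iW := bell_regular_integrable rW.
have iV := bell_regular_integrable rV.
have rNV := bell_regularN rV.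
have iNV := bell_regular_integrable rNV.
have rD := bell_regularD rW rNV.
have sum0 := qintegral_derive_fst (bell_regular_gmoment hI m n)
  (bell_regularD rW rV) (qderive_gmoment_fst hI m n).
have diff0 : qintegral leb2
    (fun z => qsandwich 1 I (wirtinger I m n z + - wirtinger_conj I m n z)) = 0.
  apply: qintegral_derive_snd (bell_regular_gmoment hI m n)
    (bell_regular_sandwich 1 I rD) _ => x y.
  by rewrite mul1r; exact: qderive_gmoment_snd.
move: sum0 diff0; rewrite qintegral_linear; last exact: bell_regular_integrable.
rewrite (qintegralD iW iV) (qintegralD iW iNV).
have -> : qintegral leb2 (fun z => - wirtinger_conj I m n z) =
    - qintegral leb2 (wirtinger_conj I m n).
  rewrite (_ : (fun z => _) =
      fun z => qsandwich (-1) 1 (wirtinger_conj I m n z)); last first.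
    by apply/funext => z; rewrite /qsandwich mulr1 mulN1r.
  by rewrite qintegral_linear//= /qsandwich mulr1 mulN1r.
move: (qintegral _ _) (qintegral _ _) => a b ab0.
rewrite /= /qsandwich mul1r => /(congr1 (fun q => q * I)).
rewrite mul0r -mulrA -expr2 hI mulrN1 => /eqP; rewrite oppr_eq0 subr_eq0 => /eqP ab.
move: ab0; rewrite ab -mulr2n -scaler_nat => /eqP.
by rewrite scaler_eq0 pnatr_eq0/= => /eqP.
Qed.

Lemma qintegralZB (a : R) m n m' n' :
  qintegral leb2 (fun z => a *: T m n z - T m' n' z) =
  a *: gauss_moment m n - gauss_moment m' n'.
Proof.
have i1 := bell_regular_integrable (bell_regular_gmoment hI m n).
have i2 := bell_regular_integrable (bell_regular_gmoment hI m' n').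
have e1 : (fun z => a *: T m n z - T m' n' z) =
    fun z => qsandwich (a *: 1) 1 (T m n z) + qsandwich (-1) 1 (T m' n' z).
  by apply/funext => z; rewrite /qsandwich !mulr1 mulN1r -scalerAl mul1r.
rewrite e1 qintegralD; [|exact: qintegrable_linear..].
by rewrite !qintegral_linear//= /qsandwich !mulr1 mulN1r -scalerAl mul1r.
Qed.

Lemma gauss_momentSl m n : gauss_moment m.+1 n = n%:R *: gauss_moment m n.-1.
Proof.
have [W0 _] := qintegral_wirtinger_eq0 m n.
by apply/esym/eqP; rewrite -subr_eq0 -qintegralZB; apply/eqP.
Qed.

Lemma gauss_momentSr m n : gauss_moment m n.+1 = m%:R *: gauss_moment m.-1 n.
Proof.
have [_ W0] := qintegral_wirtinger_eq0 m n.
by apply/esym/eqP; rewrite -subr_eq0 -qintegralZB; apply/eqP.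
Qed.

Lemma gauss_moment00 : gauss_moment 0 0 = pi *: 1.
Proof.
apply: quat_coord_inj => i; rewrite qcoordZ qcoord_qintegral.
under eq_Rintegral do rewrite /gmoment !expr0 mulr1 qcoordZ.
rewrite RintegralZr ?Rintegral_gauss2//.
have := bell_regular_integrable (bell_regular_gmoment hI 0 0) (inord 0).
by under eq_fun do rewrite /gmoment !expr0 mulr1 qcoordZ
  [qcoord 1 _](quat_oneE (R := R)) mulr1.
Qed.

(** The recurrences lower both exponents together until one of them is 0. *)
Lemma gauss_momentE m n :
  gauss_moment m n = (if m == n then m`!%:R * pi else 0) *: 1.
Proof.
elim: m n => [|m IH] [|n].
- by rewrite gauss_moment00 eqxx fact0 mul1r.
- by rewrite gauss_momentSr !scale0r.
- by rewrite gauss_momentSl !scale0r.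
rewrite gauss_momentSl IH eqSS scalerA.
by case: eqP => [->|_]; rewrite ?mulr0// factS natrM mulrA.
Qed.

End GaussianMoments.

(** * Reproduction of the Laplacian of a power by the Fock-Fueter kernel *)

Lemma fock_fueter_series_cvg {R : realType} (q s : quat R) :
  cvgn (series (fun k => expterm s k (lap_pow q k))).
Proof.
pose b := 3 * (qnorm1 q + 1) * qnorm1 s.
apply: (@dominated_series_cvg _ _ _ (fun k => 4 *: exp_coeff b k)) => [k|].
  rewrite (le_trans (norm_le_qnorm1 _))//.
  exact: qnorm1_expterm (qnorm1_lap_pow q k).
exact/is_cvg_seriesZ/is_cvg_series_exp_coeff.
Qed.

Section SliceReproduction.
Context {R : realType} (I q : quat R) (hI : imag_units I) (n : nat).
Local Notation leb2 := (@lebesgue2 R).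
Local Notation N1 := qnorm1.

(** The [j]-th term of the kernel series times [p ^ n] and the Gaussian density;
    the coefficient [lap_pow q j] stays on the left, where integration in [p]
    does not see it. *)
Definition kernel_term (j : nat) (z : R * R) : quat R :=
  qsandwich ((pi^-1 / j`!%:R) *: lap_pow q j) 1 (gmoment I j n z).

Lemma gauss_integrand_kernel z :
  gauss_integrand I (fun p => fock_fueter_kernel q p * p ^+ n) z =
  qseries (kernel_term ^~ z).
Proof.
rewrite /gauss_integrand (qmod_slice hI) -[expR _]/(gauss2 z) fock_fueter_kernelE.
set p := slice I z; set c := pi^-1 * gauss2 z.
transitivity (qsandwich (c *: 1) (p ^+ n)
    (qseries (fun k => expterm (qconj p) k (lap_pow q k)))).
  by rewrite /qsandwich -!scalerAl mul1r.
rewrite -qseries_linear; last exact: fock_fueter_series_cvg.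
congr qseries; apply/funext => j.
rewrite /= /kernel_term /qsandwich /expterm /gmoment -/p mulr1.
rewrite -!(scalerAl, scalerAr) mul1r !scalerA mulrA; congr (_ *: _).
by rewrite /c -!mulrA [gauss2 z * _]mulrC.
Qed.

(** With [r] proportional to [|x| + |y|] and [b] the growth rate of [lap_pow],
    the factor [b ^ j * r ^ j / j!] is at most [2^-j * exp (2 * b * r)]: the
    geometric factor is bought by doubling the rate of the exponential, which
    the Gaussian absorbs anyway. *)
Lemma qnorm1_kernel_term : exists C, forall j z,
  N1 (kernel_term j z) <= (1 / 2) ^+ j * (C * bell2 z).
Proof.
set b := 3 * (N1 q + 1); set K := slice_const I.
set c := (2 * b + 1) * K.
exists (4 * pi^-1 * n`!%:R * expR (c ^+ 2 / 2) ^+ 2) => j z.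
set r := `|z.1| + `|z.2|.
have b0 : 0 <= b by rewrite mulr_ge0 ?addr_ge0 ?qnorm1_ge0.
have Kr0 : 0 <= K * r by rewrite mulr_ge0 ?addr_ge0 ?qnorm1_ge0.
have g0 : 0 <= gauss2 z by exact: expR_ge0.
have pi0 : 0 <= pi^-1 :> R by rewrite invr_ge0 pi_ge0.
have a0 : 0 <= pi^-1 / j`!%:R :> R by rewrite divr_ge0 // invr_ge0.
have h1 : N1 ((pi^-1 / j`!%:R) *: lap_pow q j) <= (pi^-1 / j`!%:R) * (4 * b ^+ j).
  by rewrite qnorm1Z ger0_norm// ler_wpM2l// qnorm1_lap_pow.
have h2 := qnorm1_gmoment I j n z.
rewrite /kernel_term /qsandwich mulr1 (le_trans (qnorm1M_le h1 h2))//.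
rewrite -/K -/r exprD.
have bKr0 : 0 <= 2 * b * (K * r) by rewrite mulr_ge0// mulr_ge0.
have h3 : (2 * b * (K * r)) ^+ j <= j`!%:R * expR (2 * b * (K * r)).
  exact: powX_le_expR.
have h4 : (K * r) ^+ n <= n`!%:R * expR (K * r) by exact: powX_le_expR.
have h5 := gauss2_exp_le c z.
have f0 : j`!%:R != 0 :> R by rewrite pnatr_eq0 -lt0n fact_gt0.
have half : (1 / 2 : R) ^+ j * 2 ^+ j = 1.
  by rewrite -exprMn divfK ?pnatr_eq0// expr1n.
(* Trade [b ^ j] for [2^-j * (2 * b) ^ j]. *)
apply: (@le_trans _ _ ((1 / 2) ^+ j * (4 * pi^-1 / j`!%:R) *
    ((2 * b * (K * r)) ^+ j * (K * r) ^+ n * gauss2 z))).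
  rewrite le_eqVlt; apply/orP; left; apply/eqP.
  rewrite (exprMn j (2 * b) (K * r)) (exprMn j 2 b).
  move: ((K * r) ^+ j) ((K * r) ^+ n) (b ^+ j) (2 ^+ j) ((1 / 2) ^+ j) half.
  move=> u v w t h half.
  by rewrite -[LHS]mul1r -half; ring.
apply: (@le_trans _ _ ((1 / 2) ^+ j * (4 * pi^-1 / j`!%:R) *
    ((j`!%:R * expR (2 * b * (K * r))) * (n`!%:R * expR (K * r)) * gauss2 z))).
  apply: ler_wpM2l.
    by apply: mulr_ge0; [exact: exprn_ge0|rewrite -mulrA mulr_ge0].
  by apply: ler_wpM2r => //; apply: ler_pM => //; exact: exprn_ge0.
apply: (@le_trans _ _ ((1 / 2) ^+ j * (4 * pi^-1 * n`!%:R) *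
    (expR (c * r) * gauss2 z))).
  have -> : c * r = 2 * b * (K * r) + K * r by rewrite /c; ring.
  rewrite expRD le_eqVlt; apply/orP; left; apply/eqP.
  by move: f0 (pi^-1); move: (j`!%:R) => J J0 P; field; rewrite J0.
rewrite -mulrA ler_wpM2l ?exprn_ge0// -[leRHS]mulrA.
by rewrite ler_wpM2l// !mulr_ge0.
Qed.

Lemma qintegral_kernel_term j :
  qintegral leb2 (kernel_term j) = if j == n then lap_pow q n else 0.
Proof.
have iT := bell_regular_integrable (bell_regular_gmoment hI j n).
rewrite /kernel_term qintegral_linear//= -/(gauss_moment I j n) gauss_momentE//.
rewrite /qsandwich mulr1 -scalerAr mulr1; case: eqP => [->|_]; last exact: scale0r.
rewrite scalerA mulrACA mulrC mulrA.
rewrite -[X in X *: _]/(_) (_ : _ * _ = 1) ?scale1r//.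
have f0 : n`!%:R != 0 :> R by rewrite pnatr_eq0 -lt0n fact_gt0.
have p0 : pi != 0 :> R by rewrite gt_eqF ?pi_gt0.
by rewrite divfK// divff.
Qed.

(** Integrating the series termwise against [p ^ n], only the term of index [n]
    survives, and its moment [n! * pi] cancels the factor [pi^-1 / n!]. *)
Lemma kernel_reproduces_lap_pow :
  mu_integrable I (fun p => fock_fueter_kernel q p * p ^+ n) /\
  mu_integral I (fun p => fock_fueter_kernel q p * p ^+ n) = lap_pow q n.
Proof.
have [C kC] := qnorm1_kernel_term.
have ig : leb2.-integrable setT (EFin \o (fun z => C * bell2 z)).
  rewrite (_ : _ \o _ = fun z => (C%:E * (bell2 z)%:E)%E)//.
  by apply: integrableZl => //; exact: integrable_bell2.
have mF j : qmeasurable (kernel_term j).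
  by apply: qmeasurable_linear; exact: qmeasurable_gmoment.
have F0 j : j != n -> qintegral leb2 (kernel_term j) = 0.
  by rewrite qintegral_kernel_term => /negbTE ->.
rewrite /mu_integrable /mu_integral.
rewrite (_ : gauss_integrand I _ = fun z => qseries (kernel_term ^~ z)); last first.
  by apply/funext => z; exact: gauss_integrand_kernel.
have [iK eK] := @qintegral_qseries1 R _ _ leb2 kernel_term _ n mF kC ig F0.
by split; rewrite // eK qintegral_kernel_term eqxx.
Qed.

End SliceReproduction.

(** * Hermite polynomials and functions *)

Section HermitePolynomials.
Context {R : realType}.
Local Notation leb := (@lebesgue_measure R).
Implicit Types (P Q : {poly R}) (m n : nat) (x t : R).

Fixpoint hermite_poly n : {poly R} :=
  if n is m.+1 then 2 *: 'X * hermite_poly m - (hermite_poly m)^`() else 1.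
Local Notation hp := hermite_poly.

Lemma is_derive_poly_gauss P x :
  is_derive x (1 : R) (fun y => P.[y] * gauss_fun y)
    ((P^`() - 2 *: 'X * P).[x] * gauss_fun x).
Proof.
rewrite /gauss_fun; apply: is_derive_eq.
by rewrite !hornerE /GRing.scale/=; ring.
Qed.

(** Rodrigues' formula. *)
Lemma derive1n_gauss n : derive1n n (fun y : R => expR (- y ^+ 2)) =
  fun x => ((-1) ^+ n *: hp n).[x] * gauss_fun x.
Proof.
elim: n => [|n IH].
  by rewrite derive1n0; apply/funext => x; rewrite expr0 scale1r hornerC mul1r.
rewrite derive1nS IH; apply/funext => x; rewrite derive1E.
have d := is_derive_poly_gauss ((-1) ^+ n *: hp n) x.
rewrite derive_val; congr (_.[x] * _).
by rewrite /= derivZ -scalerAr -scalerBr exprS mulN1r scaleNr -scalerN opprB.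
Qed.

Lemma hermiteE n x : hermite n x = (hp n).[x] * bell x.
Proof.
rewrite /hermite derive1n_gauss hornerZ.
have sgn : (-1) ^+ n * (-1) ^+ n = 1 :> R by rewrite -exprMn mulrNN mulr1 expr1n.
have <- : expR (x ^+ 2 / 2) * gauss_fun x = bell x.
  by rewrite /gauss_fun -expRD /bell; congr expR; lra.
transitivity (((-1) ^+ n * (-1) ^+ n) *
    ((hp n).[x] * (expR (x ^+ 2 / 2) * gauss_fun x))); first by ring.
by rewrite sgn mul1r.
Qed.

Lemma deriv_hermite_poly n : (hp n.+1)^`() = (2 * n.+1%:R) *: hp n.
Proof.
elim: n => [|n IH].
  by rewrite /= mulr1 -polyC1 derivC subr0 derivZ derivX polyC1 mulr1.
rewrite [hp n.+2]/= -/(hp n.+1) derivB derivM derivZ derivX IH.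
rewrite [in RHS]/= -/(hp n.+1).
rewrite derivZ -scalerAr -addrA -scalerBr -[X in _ + _ *: X]/(hp n.+1).
by rewrite -scalerAl mul1r -scalerDl; congr (_ *: _); rewrite -[in RHS]natr1; ring.
Qed.

Lemma hermite_polySS n :
  hp n.+2 = 2 *: 'X * hp n.+1 - (2 * n.+1%:R) *: hp n.
Proof. by rewrite -deriv_hermite_poly. Qed.

(** Multiplying by [c] shifts the partial sum of the exponential series, with
    [c ^ j.+1 / j! = j.+1 * (c ^ j.+1 / j.+1!)] and [j.+1 <= n]. *)
Lemma exp_partial_sum_mul (c : R) n : 0 <= c ->
  c * \sum_(j < n) c ^+ j / j`!%:R <= n%:R * \sum_(j < n.+1) c ^+ j / j`!%:R.
Proof.
move=> c0; rewrite mulr_sumr big_ord_recl mulrDr.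
rewrite -[leLHS]add0r lerD ?mulr_ge0 ?divr_ge0//.
rewrite mulr_sumr; apply: ler_sum => j _; rewrite /bump/= ?add1n factS natrM invfM.
rewrite exprS mulrA [leRHS](_ : _ = n%:R / j.+1%:R * (c * c ^+ j / j`!%:R));
  last by ring.
rewrite ler_peMl ?divr_ge0 ?mulr_ge0 ?exprn_ge0//.
by rewrite ler_pdivlMr ?mul1r ?ler_nat ?ltr0n.
Qed.

Lemma exp_partial_sum_le (c : R) n : 0 <= c ->
  \sum_(j < n) c ^+ j / j`!%:R <= expR c.
Proof.
move=> c0; rewrite -(big_mkord xpredT (fun j => c ^+ j / j`!%:R)).
apply: (@nondecreasing_cvgn_le _ (series (exp_coeff c))).
  by apply: nondecreasing_series => j _ _; exact: exp_coeff_ge0.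
exact: is_cvg_series_exp_coeff.
Qed.

Lemma exp_partial_sum_nondecreasing (c : R) n : 0 <= c ->
  \sum_(j < n) c ^+ j / j`!%:R <= \sum_(j < n.+1) c ^+ j / j`!%:R.
Proof. by move=> c0; rewrite big_ord_recr lerDl divr_ge0 ?exprn_ge0. Qed.

(** One step of the three-term recurrence multiplies the bound by at most [c],
    and [exp_partial_sum_mul] turns this factor into one more term of the
    partial sum. The bound by [exp c] alone is not preserved by a step when [n]
    is small compared to [c]. *)
Lemma hermite_poly_partial_bound n t x c : 0 <= t ->
  c = 2 * `|x| * t + 2 * t ^+ 2 ->
  `|(hp n).[x]| * t ^+ n <= n`!%:R * \sum_(j < n.+1) c ^+ j / j`!%:R.
Proof.
move=> t0 cE; have c0 : 0 <= c by rewrite cE addr_ge0 ?mulr_ge0 ?exprn_ge0.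
pose S n := \sum_(j < n.+1) c ^+ j / j`!%:R.
suff : `|(hp n).[x]| * t ^+ n <= n`!%:R * S n /\
    `|(hp n.+1).[x]| * t ^+ n.+1 <= n.+1`!%:R * S n.+1 by case.
elim: n => [|n [IH0 IH1]].
  rewrite /S !big_ord_recl !big_ord0 /= /bump /= mulr1 -polyC1 derivC subr0.
  rewrite hornerM hornerZ hornerX !hornerC addn0 fact0 !factS fact0 !expr0 !expr1.
  rewrite normr1 !addr0 !mulr1 !mul1r !invr1 normrM (@ger0_norm _ 2)//; split => //.
  by rewrite cE; have := exprn_ge0 2 t0; lra.
split => //.
rewrite hermite_polySS hornerD hornerN hornerM !hornerZ hornerX.
have S0 : 0 <= S n.+1 by rewrite sumr_ge0// => j _; rewrite divr_ge0 ?exprn_ge0.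
have SS : S n <= S n.+1 by exact: exp_partial_sum_nondecreasing.
have cS : c * S n.+1 <= n.+2%:R * S n.+2 by exact: exp_partial_sum_mul.
apply: (@le_trans _ _ (2 * `|x| * t * (n.+1`!%:R * S n.+1) +
    2 * n.+1%:R * t ^+ 2 * (n`!%:R * S n))).
  apply: (@le_trans _ _ ((2 * `|x| * `|(hp n.+1).[x]| +
      2 * n.+1%:R * `|(hp n).[x]|) * t ^+ n.+2)).
    rewrite ler_wpM2r ?exprn_ge0// (le_trans (ler_normB _ _))//.
    by rewrite !normrM !(@ger0_norm _ 2)// (@ger0_norm _ n.+1%:R).
  rewrite mulrDl lerD//.
    rewrite exprS [leLHS](_ : _ = 2 * `|x| * t *
      (`|(hp n.+1).[x]| * t ^+ n.+1)); last by ring.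
    by rewrite ler_wpM2l ?mulr_ge0.
  rewrite (exprS t n.+1) (exprS t n) [leLHS](_ : _ =
    2 * n.+1%:R * t ^+ 2 * (`|(hp n).[x]| * t ^+ n)); last by ring.
  by rewrite ler_wpM2l ?mulr_ge0 ?exprn_ge0.
apply: (@le_trans _ _ (n.+1`!%:R * (c * S n.+1))).
  rewrite (_ : 2 * n.+1%:R * t ^+ 2 * (n`!%:R * S n) =
    n.+1`!%:R * (2 * t ^+ 2 * S n)); last by rewrite factS natrM; ring.
  rewrite [2 * `|x| * t * _]mulrCA -mulrDr ler_wpM2l//.
  rewrite cE [leRHS]mulrDl lerD2l ler_wpM2l//.
  by rewrite mulr_ge0 ?exprn_ge0.
by rewrite [n.+2`!]factS natrM -mulrA [leRHS]mulrCA ler_wpM2l.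
Qed.

(** The Cauchy-type estimate suggested by the generating function
    [exp (2 x t - t ^ 2)]; the free parameter [t] yields any geometric decay of
    [hermite n / n!]. *)
Lemma hermite_poly_bound n t x : 0 <= t ->
  `|(hp n).[x]| * t ^+ n <= n`!%:R * expR (2 * `|x| * t + 2 * t ^+ 2).
Proof.
move=> t0; rewrite (le_trans (hermite_poly_partial_bound n t0 erefl))//.
rewrite ler_wpM2l// exp_partial_sum_le// addr_ge0 ?mulr_ge0 ?exprn_ge0//.
Qed.

End HermitePolynomials.

Section HermiteOrthogonality.
Context {R : realType}.
Local Notation leb := (@lebesgue_measure R).
Implicit Types (P Q : {poly R}) (m n : nat) (x t : R).
Local Notation hp := hermite_poly.

(** Each monomial [|x| ^ i] is at most [i! * exp |x|]. *)
Lemma poly_gauss_le_bell P : exists C, forall x,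
  `|P.[x] * gauss_fun x| <= C * bell x.
Proof.
exists ((\sum_(i < size P) `|P`_i| * i`!%:R) * expR (1 ^+ 2 / 2)) => x.
rewrite normrM (ger0_norm (expR_ge0 _)) -mulrA.
apply: (le_trans _ (ler_wpM2l _ (expR_abs_gauss 1 x))); last first.
  by rewrite sumr_ge0// => i _; rewrite mulr_ge0.
rewrite mulrA ler_wpM2r ?expR_ge0// mul1r horner_coef.
rewrite (le_trans (ler_norm_sum _ _ _))// mulr_suml; apply: ler_sum => i _.
by rewrite normrM normrX -mulrA ler_wpM2l// powX_le_expR.
Qed.

Lemma measurable_poly_gauss P : measurable_fun setT (fun x => P.[x] * gauss_fun x).
Proof.
apply: measurable_funM; last exact: measurable_gauss_fun.
by apply: continuous_measurable_fun; exact: continuous_horner.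
Qed.

Lemma integrable_poly_gauss P :
  leb.-integrable setT (EFin \o (fun x => P.[x] * gauss_fun x)).
Proof.
have [C PC] := poly_gauss_le_bell P.
exact: integrable_le_bell (measurable_poly_gauss P) PC.
Qed.

Definition gauss_int P := \int[leb]_x (P.[x] * gauss_fun x).

Lemma gauss_intZ a P : gauss_int (a *: P) = a * gauss_int P.
Proof.
rewrite /gauss_int -RintegralZl//; last exact: integrable_poly_gauss.
by apply: eq_Rintegral => x _; rewrite hornerZ mulrA.
Qed.

Lemma gauss_intB P Q : gauss_int (P - Q) = gauss_int P - gauss_int Q.
Proof.
rewrite /gauss_int -RintegralB//; [|exact: integrable_poly_gauss..].
by apply: eq_Rintegral => x _; rewrite hornerD hornerN mulrBl.
Qed.

Lemma gauss_int_deriv P : gauss_int (P^`() - 2 *: 'X * P) = 0.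
Proof.
have [C PC] := poly_gauss_le_bell P.
have [D DC] := poly_gauss_le_bell (P^`() - 2 *: 'X * P).
apply: (Rintegral_derive_bell (C := Num.max C D) (is_derive_poly_gauss P)).
- move=> x; apply: cvgM; first exact: continuous_horner.
  exact: continuous_gauss_fun.
- by move=> x; rewrite (le_trans (PC x))// ler_wpM2r ?bell_ge0// le_max lexx.
- by move=> x; rewrite (le_trans (DC x))// ler_wpM2r ?bell_ge0// le_max lexx orbT.
Qed.

(** Integration by parts, since [hermite_poly n.+1] times the Gaussian is minus
    the derivative of [hermite_poly n] times the Gaussian. *)
Lemma gauss_int_hermiteS n Q :
  gauss_int (hp n.+1 * Q) = gauss_int (hp n * Q^`()).
Proof.
apply/esym/eqP; rewrite -subr_eq0 -gauss_intB.
rewrite -[X in _ == X](gauss_int_deriv (hp n * Q)).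
apply/eqP; congr gauss_int; rewrite derivM /= mulrBl -mulrA opprB addrA; congr (_ - _).
by rewrite addrC.
Qed.

(** As for the complex moments, each integration by parts lowers both indices,
    because the derivative of a Hermite polynomial is a multiple of the
    preceding one. *)
Lemma gauss_int_hermite m n : gauss_int (hp m * hp n) =
  if m == n then 2 ^+ n * n`!%:R * Num.sqrt pi else 0.
Proof.
elim: m n => [|m IH] [|n].
- rewrite /= mulr1 /gauss_int fact0 expr0 !mul1r.
  under eq_Rintegral do rewrite hornerC mul1r.
  by rewrite /Rintegral integralT_gauss.
- rewrite mulrC gauss_int_hermiteS/= -polyC1 derivC mulr0.
  by rewrite -(scale0r 0) gauss_intZ mul0r.
- rewrite gauss_int_hermiteS/= -polyC1 derivC mulr0.
  by rewrite -(scale0r 0) gauss_intZ mul0r.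
rewrite gauss_int_hermiteS deriv_hermite_poly -scalerAr gauss_intZ IH eqSS.
by case: eqP => _; rewrite ?mulr0// exprS factS natrM; ring.
Qed.

Lemma hermite_mulE m n x :
  hermite m x * hermite n x = (hp m * hp n).[x] * gauss_fun x.
Proof.
rewrite !hermiteE hornerM mulrACA; congr (_ * _).
by rewrite /bell /gauss_fun -expRD; congr expR; lra.
Qed.

Lemma hermite_bound n t x : 0 < t ->
  `|hermite n x| <= n`!%:R / t ^+ n * expR (2 * `|x| * t + 2 * t ^+ 2) * bell x.
Proof.
move=> t0; rewrite hermiteE normrM (ger0_norm (bell_ge0 _)) ler_wpM2r ?bell_ge0//.
rewrite mulrAC ler_pdivlMr ?exprn_gt0//.
by apply: hermite_poly_bound; exact: ltW.
Qed.

End HermiteOrthogonality.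

(** * Reproduction by the Segal-Bargmann-Fueter kernel *)

Section HermiteReproduction.
Context {R : realType} (q : quat R) (n : nat).
Local Notation leb := (@lebesgue_measure R).
Local Notation N1 := qnorm1.
Local Notation hp := hermite_poly.
Implicit Types (x : R) (j : nat).

(** Read off from the bound on [lap_pow]; keeping the denominator lets it cancel
    the factor [(j + 2)! / j!] of [hermite_term]. *)
Lemma qnorm1_Qpoly j : N1 (Qpoly j q) <=
  2 / ((j + 1)%:R * (j + 2)%:R) * (3 * (N1 q + 1)) ^+ (j + 2).
Proof.
have := qnorm1_lap_pow q j.+2; rewrite lap_powSSE qnorm1Z normrN -mulrA.
have c0 : 0 < (j + 1)%:R * (j + 2)%:R :> R by rewrite mulr_gt0 ?ltr0n ?addn1 ?addn2.
move: (_ * _) c0 => d d0; rewrite (addn2 j) (ger0_norm (mulr_ge0 _ (ltW d0)))//.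
rewrite -ler_pdivlMl ?mulr_gt0// => /le_trans; apply.
rewrite le_eqVlt; apply/orP; left; apply/eqP.
by field; rewrite gt_eqF.
Qed.

Definition hermite_term j x : quat R :=
  (hermite (j + 2) x / (2 `^ (j%:R / 2) * j`!%:R)) *: Qpoly j q.

(** The Hermite bound is used with [t] equal to twice the growth rate of
    [Qpoly], which leaves a ratio 1/2. *)
Lemma hermite_term_bound : exists D c, forall j x,
  N1 (hermite_term j x) <= (1 / 2) ^+ j * (D * expR (c * `|x|) * bell x).
Proof.
set b := 3 * (N1 q + 1).
have b0 : 0 < b by rewrite mulr_gt0// ltr_wpDl// qnorm1_ge0.
set t := 2 * b; have t0 : 0 < t by rewrite mulr_gt0.
exists (expR (2 * t ^+ 2)), (2 * t) => j x.
set P := 2 `^ (j%:R / 2) : R.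
have p1 : 1 <= P by rewrite -[leLHS](powRr0 2) ler_powR// ?ler1n// divr_ge0.
have P0 : 0 < P by exact: lt_le_trans p1.
have h1 := hermite_bound (j + 2) x t0; have h2 := qnorm1_Qpoly j.
have f0 : 0 < j`!%:R :> R by rewrite ltr0n fact_gt0.
have d0 : 0 < (j + 1)%:R * (j + 2)%:R :> R by rewrite mulr_gt0 ?ltr0n ?addn1 ?addn2.
have fE : (j + 2)`!%:R = (j + 1)%:R * (j + 2)%:R * j`!%:R :> R.
  by rewrite addn2 !factS !natrM addn1 mulrCA mulrA.
rewrite fE -/b in h1 h2; move: d0 fE h1 h2; move: (_ * (j + 2)%:R) => d d0 _ h1 h2.
have EE : expR (2 * t ^+ 2) * expR (2 * t * `|x|) =
    expR (2 * `|x| * t + 2 * t ^+ 2).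
  by rewrite -expRD; congr expR; ring.
rewrite /hermite_term qnorm1Z normrM normfV (ger0_norm (ltW (mulr_gt0 P0 f0))) EE.
apply: (le_trans (ler_pM _ _ (ler_wpM2r _ h1) h2)).
- by rewrite mulr_ge0// invr_ge0 ltW ?mulr_gt0.
- exact: qnorm1_ge0.
- by rewrite invr_ge0 ltW ?mulr_gt0.
move: (expR _) (expR_ge0 (2 * `|x| * t + 2 * t ^+ 2)) => E E0.
(* [(j + 2)!] cancels [d * j!] and [b ^ (j + 2) / t ^ (j + 2)] is a power of 1/2;
   the factor [P^-1 <= 1] is dropped afterwards. *)
rewrite [leLHS](_ : _ = P^-1 * ((1 / 2) ^+ j * (1 / 2) * (E * bell x))).
  rewrite -[leRHS]mul1r ler_pM ?mulr_ge0 ?invr_ge0 ?exprn_ge0 ?bell_ge0 ?divr_ge0//.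
  - exact: ltW.
  - by rewrite invf_le1.
  - by rewrite ler_wpM2r ?mulr_ge0 ?bell_ge0// ler_piMr ?exprn_ge0//; lra.
rewrite /t exprMn expr_div_n expr1n exprD.
have bj0 : b ^+ (j + 2) != 0 by rewrite expf_neq0// gt_eqF.
have tj0 : 2 ^+ j != 0 :> R by rewrite expf_neq0.
move: bj0 tj0; move: (b ^+ (j + 2)) (2 ^+ j) => u v u0 v0.
by field; rewrite u0 v0 !gt_eqF.
Qed.

Lemma hermite_term_cvg x : cvgn (series (hermite_term ^~ x)).
Proof.
have [D [c Dc]] := hermite_term_bound.
apply: (@dominated_series_cvg _ _ _
    (geometric (D * expR (c * `|x|) * bell x) (1 / 2))) => [j|].
  by rewrite (le_trans (norm_le_qnorm1 _))//= mulrC.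
exact/is_cvg_geometric_series/geometric_half_lt1.
Qed.

Definition bargmann_term j x : quat R :=
  (- (pi `^ (1 / 4))^-1 * hermite n x) *: hermite_term j x.

Lemma hermite_bargmann_kernel x :
  hermite n x *: segal_bargmann_fueter_kernel q x = qseries (bargmann_term ^~ x).
Proof.
rewrite /segal_bargmann_fueter_kernel /qseries scalerA [hermite n x * _]mulrC.
by rewrite -limn_seriesZ//; exact: hermite_term_cvg.
Qed.

Lemma bargmann_termE j x : bargmann_term j x =
  ((hp n * hp (j + 2)).[x] * gauss_fun x) *:
    ((- (pi `^ (1 / 4))^-1 / (2 `^ (j%:R / 2) * j`!%:R)) *: Qpoly j q).
Proof.
rewrite /bargmann_term /hermite_term !scalerA -hermite_mulE; congr (_ *: _).
by ring.
Qed.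

Lemma bargmann_term_bound : exists C, forall j x,
  N1 (bargmann_term j x) <= (1 / 2) ^+ j * (C * bell x).
Proof.
have [D [c Dc]] := hermite_term_bound.
have D0 : 0 <= D.
  have := le_trans (qnorm1_ge0 _) (Dc 0%N 0).
  by rewrite expr0 mul1r pmulr_lge0 ?bell_gt0// pmulr_lge0 ?expR_gt0.
set a := `|- (pi `^ (1 / 4))^-1 : R|.
have a0 : 0 <= a by exact: normr_ge0.
exists (a * n`!%:R * expR 2 * D * expR ((2 + c) ^+ 2 / 2)) => j x.
have h1 := hermite_bound n x (@ltr01 R).
rewrite !expr1n divr1 !mulr1 in h1.
rewrite /bargmann_term qnorm1Z normrM -/a.
apply: (le_trans (ler_pM _ _ (ler_wpM2l _ h1) (Dc j x))) => //.
- by rewrite mulr_ge0.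
- exact: qnorm1_ge0.
have h2 := expR_abs_gauss (2 + c) x.
have gE : expR (- x ^+ 2) = bell x * bell x.
  by rewrite /bell -expRD; congr expR; lra.
rewrite gE mulrDl expRD in h2; rewrite expRD.
rewrite [leLHS](_ : _ = (1 / 2) ^+ j * (a * n`!%:R * expR 2 * D) *
    (expR (2 * `|x|) * expR (c * `|x|) * (bell x * bell x))); last by ring.
rewrite [leRHS](_ : _ = (1 / 2) ^+ j * (a * n`!%:R * expR 2 * D) *
    (expR ((2 + c) ^+ 2 / 2) * bell x)); last by ring.
by rewrite ler_wpM2l// !mulr_ge0 ?exprn_ge0 ?expR_ge0 ?divr_ge0 ?normr_ge0.
Qed.

Lemma qmeasurable_bargmann_term j : qmeasurable (bargmann_term j).
Proof.
rewrite (_ : bargmann_term j = fun x =>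
    ((hp n * hp (j + 2)).[x] * gauss_fun x) *:
      ((- (pi `^ (1 / 4))^-1 / (2 `^ (j%:R / 2) * j`!%:R)) *: Qpoly j q)); last first.
  by apply/funext => x; exact: bargmann_termE.
by apply: qmeasurableZ; [exact: measurable_poly_gauss|exact: qmeasurable_cst].
Qed.

Lemma qintegral_bargmann_term j : qintegral leb (bargmann_term j) =
  (if n == (j + 2)%N then 2 ^+ n * n`!%:R * Num.sqrt pi else 0) *:
    ((- (pi `^ (1 / 4))^-1 / (2 `^ (j%:R / 2) * j`!%:R)) *: Qpoly j q).
Proof.
apply: quat_coord_inj => i; rewrite qcoordZ qcoord_qintegral.
under eq_Rintegral do rewrite bargmann_termE qcoordZ.
rewrite RintegralZr//; last exact: integrable_poly_gauss.
rewrite -/(gauss_int _) gauss_int_hermite.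
by case: eqP => [->|].
Qed.

End HermiteReproduction.

(** Orthogonality of the Hermite functions leaves the single term of index
    [k]. *)
Lemma hermite_reproduces_Qpoly {R : realType} (q : quat R) k :
  let f x := hermite (k + 2) x *: segal_bargmann_fueter_kernel q x in
  qintegrable (@lebesgue_measure R) f /\
  qintegral (@lebesgue_measure R) f =
    (2 ^+ (k + 2) * (k + 2)`!%:R * Num.sqrt pi) *:
    ((- (pi `^ (1 / 4))^-1 / (2 `^ (k%:R / 2) * k`!%:R)) *: Qpoly k q).
Proof.
move=> f; have [C kC] := bargmann_term_bound q (k + 2).
have ig : (@lebesgue_measure R).-integrable setT (EFin \o (fun x => C * bell x)).
  rewrite (_ : _ \o _ = fun z => (C%:E * (bell z)%:E)%E)//.
  by apply: integrableZl => //; exact: integrable_bell.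
have F0 j : j != k -> qintegral lebesgue_measure (bargmann_term q (k + 2) j) = 0.
  by move=> jk; rewrite qintegral_bargmann_term eqn_add2r eq_sym (negbTE jk) scale0r.
rewrite /f (_ : (fun x => _) = fun x => qseries (bargmann_term q (k + 2) ^~ x));
  last by apply/funext => x; exact: hermite_bargmann_kernel.
have [iK eK] := @qintegral_qseries1 R _ _ lebesgue_measure
  (bargmann_term q (k + 2)) _ k (qmeasurable_bargmann_term q (k + 2)) kC ig F0.
by split; rewrite // eK qintegral_bargmann_term eqxx.
Qed.

(** * The two integral representations *)

Theorem proposition4p21 (R : realType) (I q : quat R) (hI : imag_units I)
    (k : nat) :
  (mu_integrable I (fun p => fock_fueter_kernel q p * p ^+ (k + 2)) /\
   Qpoly k q =
     - (2 * (k + 1)%:R * (k + 2)%:R)^-1 *: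
       mu_integral I (fun p => fock_fueter_kernel q p * p ^+ (k + 2))) /\
  (qintegrable (@lebesgue_measure R)
     (fun x => hermite (k + 2) x *: segal_bargmann_fueter_kernel q x) /\
   Qpoly k q =
     - (4 * pi `^ (1 / 4) * 2 `^ (k%:R / 2) * (k + 1)%:R * (k + 2)%:R)^-1 *:
       qintegral (@lebesgue_measure R)
         (fun x => hermite (k + 2) x *: segal_bargmann_fueter_kernel q x)).
Proof.
have k1 : (k + 1)%:R != 0 :> R by rewrite pnatr_eq0 addn1.
have k2 : (k + 2)%:R != 0 :> R by rewrite pnatr_eq0 addn2.
split.
  have [iK ->] := kernel_reproduces_lap_pow q hI (k + 2); split => //.
  have -> : lap_pow q (k + 2) = lap_pow q k.+2 by rewrite addn2.
  by rewrite lap_powSSE scalerA mulrNN mulVf ?scale1r// !mulf_neq0.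
have [iK ->] := hermite_reproduces_Qpoly q k; split => //.
rewrite !scalerA -[LHS]scale1r; congr (_ *: _).
have fE : (k + 2)`!%:R = (k + 1)%:R * (k + 2)%:R * k`!%:R :> R.
  by rewrite addn2 !factS !natrM addn1 mulrCA mulrA.
have piE : Num.sqrt pi = pi `^ (1 / 4) * pi `^ (1 / 4) :> R.
  rewrite -powRD; last by rewrite gt_eqF ?pi_gt0 ?implybT.
  by rewrite -powR12_sqrt ?pi_ge0//; congr (_ `^ _); field.
have twoE : 2 ^+ k = 2 `^ (k%:R / 2) * 2 `^ (k%:R / 2) :> R.
  rewrite -powRD; last by rewrite pnatr_eq0 implybT.
  by rewrite -powR_mulrn//; congr (_ `^ _); field.
rewrite fE piE exprD twoE.
have p0 : pi `^ (1 / 4) != 0 :> R by rewrite gt_eqF// powR_gt0// pi_gt0.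
have t0 : 2 `^ (k%:R / 2) != 0 :> R by rewrite gt_eqF// powR_gt0.
have f0 : k`!%:R != 0 :> R by rewrite pnatr_eq0 -lt0n fact_gt0.
move: k1 k2 p0 t0 f0.
move: (k + 1)%:R (k + 2)%:R (pi `^ (1 / 4)) (2 `^ (k%:R / 2)) k`!%:R.
move=> a b c d f a0 b0 c0 d0 f0.
by field; rewrite a0 b0 c0 d0 f0.
Qed.
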